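(* Consider an $n\times n$ input-queued switch under uniform traffic, with mean arrival rate matrix $\boldsymbol\lambda=\frac{1-\epsilon}{n}\mathbf 1$, $\epsilon\in(0,1)$, operated under random scheduling (in every time slot the schedule $\mathbf s(t)$ is drawn uniformly at random from the set of all $n\times n$ permutation matrices, independently of the past). Then the process $\mathbf q(t)$ forms a positive recurrent Markov chain, and $$\lim_{\epsilon\downarrow 0}\epsilon\,\mathbb E\Big[\sum_{i,j}\bar q_{ij}\Big]=\frac n2\|\tilde{\boldsymbol\sigma}\|^2+\frac{n(n-1)}2 .$$ Moreover, if the arrival process is uniform Bernoulli traffic (each $a_{ij}(t)$ is Bernoulli with mean $(1-\epsilon)/n$), then $$\lim_{\epsilon\downarrow 0}\epsilon\,\mathbb E\Big[\sum_{i,j}\bar q_{ij}\Big]=n(n-1).$$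
   Context: Switch model. Fix $n$; time slots are $t=0,1,2,\dots$. $\mathbf q(t)\in\mathbb Z_{\ge0}^{n\times n}$ is the queue length matrix, $\mathbf a(t)\in\mathbb Z_{\ge0}^{n\times n}$ the arrival matrix, and the schedule $\mathbf s(t)$ is an $n\times n$ permutation matrix. The evolution is $q_{ij}(t+1)=\max\{0,\,q_{ij}(t)+a_{ij}(t)-s_{ij}(t)\}$. $\mathbf 1$ is the $n\times n$ all-ones matrix; $\|\cdot\|$ is the Frobenius norm. Arrivals. (i) For each $(i,j)$, $a_{ij}(t)$ is i.i.d. in $t$; (ii) the arrival processes are independent across pairs $(i,j)$; (iii) $a_{ij}(t)\le a_{\max}<\infty$ for all $i,j,t$, with $a_{\max}$ not depending on $\epsilon$; (iv) $\mathbb P(\mathbf a(t)=\mathbf 0)>0$. The arrivals $\mathbf a(t)$ are independent of queue lengths and schedules up to time $t$. $\mathbb E[\mathbf a(t)]=\boldsymbol\lambda$; $\boldsymbol\sigma$ is the matrix with $\sigma_{ij}^2=\mathrm{Var}(a_{ij}(t))$, so $\|\boldsymbol\sigma\|^2=\sum_{ij}\sigma_{ij}^2$. One considers a family of such systems indexed by $\epsilon\in(0,1)$; the law of the arrivals may depend on $\epsilon$, and the entrywise variances $\boldsymbol\sigma^2$ converge to $\tilde{\boldsymbol\sigma}^2$ as $\epsilon\downarrow0$. Uniform traffic means all $\lambda_{ij}$ are equal (the variances may differ). The state space of the chain $\mathbf q(t)$ is taken to be the set of states reachable from $\mathbf 0$. $\bar{\mathbf q}$ denotes a random matrix with the steady-state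 (limiting) distribution of $\mathbf q(t)$ (for the given $\epsilon$). *)

(* Defs.v *)
From HB Require Import structures.
From mathcomp Require Import all_boot all_order all_algebra all_fingroup finmap.
From mathcomp Require Import all_classical all_reals all_analysis.

Set Implicit Arguments.
Unset Strict Implicit.
Unset Printing Implicit Defensive.

Import Order.TTheory GRing.Theory Num.Theory.
Import numFieldNormedType.Exports.

Local Open Scope classical_set_scope.
Local Open Scope ring_scope.
Local Open Scope ereal_scope.

Section discrete_probability.
Context {d : measure_display} {T : measurableType d} {R : realType}.
Variable P : probability T R.

(* [E] is meant to be countable and is given the discrete sigma-algebra, so
   that all preimages [X @^-1` A] are then events. *)
Definition discrete_rv {E : Type} (X : T -> E) :=
  forall x : E, measurable (X @^-1` [set x]).

Definition independent_rvs {E F : Type} (X : T -> E) (Y : T -> F) :=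
  forall (A : set E) (B : set F),
    P (X @^-1` A `&` Y @^-1` B) = P (X @^-1` A) * P (Y @^-1` B).

(* The product is taken in [R] because the library has no [\prod] in [\bar R];
   probabilities are finite, so [fine] loses nothing. *)
Definition mutually_independent {I : choiceType} {E : Type}
    (X : I -> T -> E) :=
  forall (J : {fset I}) (A : I -> set E),
    P (\bigcap_(k in [set` J]) (X k @^-1` A k)) =
    (\prod_(k <- J) fine (P (X k @^-1` A k)))%R%:E.

Definition identically_distributed {E : Type} (X : nat -> T -> E) :=
  forall (t : nat) (A : set E), P (X t @^-1` A) = P (X 0%N @^-1` A).

Definition law {E : Type} (X : T -> E) (x : E) : \bar R :=
  P (X @^-1` [set x]).

(* The list of the values taken at times 0, ..., t - 1. *)
Definition history {E : Type} (X : nat -> T -> E) (t : nat) (w : T) : seq E :=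
  [seq X k w | k <- iota 0 t].

End discrete_probability.

Section markov_chains.
Context {R : realType} {S : countType}.
Variable K : S -> S -> \bar R.

Definition reachable (x y : S) :=
  exists2 p : seq S, path (fun u v => 0 < K u v) x p & y = last x p.

Record is_markov_chain {d} {T : measurableType d} (P : probability T R)
    (D : set S) (X : nat -> T -> S) : Prop := IsMarkovChain {
  chain_kernel_ge0 : forall x y, D x -> 0 <= K x y;
  chain_kernel_sum1 : forall x, D x -> \esum_(y in D) K x y = 1;
  chain_rv : forall t, discrete_rv (X t);
  chain_in_state_space : forall t, P (X t @^-1` D) = 1;
  chain_markov : forall (t : nat) (x : nat -> S) (y : S),
    P ([set w | forall k, (k <= t)%N -> X k w = x k] `&`
       X t.+1 @^-1` [set y]) =
    P [set w | forall k, (k <= t)%N -> X k w = x k] * K (x t) y }.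

(* [first_passage y k x] is the probability that the chain started at [x]
   visits [y] at time [k.+1] and not at any of the times 1, ..., k. *)
Fixpoint first_passage (y : S) (k : nat) (x : S) : \bar R :=
  if k is k'.+1 then \esum_(z in ~` [set y]) (K x z * first_passage y k' z)
  else K x y.

Definition positive_recurrent_state (x : S) :=
  \sum_(0 <= k <oo) first_passage x k x = 1 /\
  \sum_(0 <= k <oo) (k.+1%:R%:E * first_passage x k x) < +oo.

Definition positive_recurrent (D : set S) :=
  forall x, D x -> positive_recurrent_state x.

Definition stationary (mu : S -> \bar R) :=
  forall y, mu y = \esum_(x in setT) (mu x * K x y).

Record steady_state_law {d} {T : measurableType d} (P : probability T R)
    (X : nat -> T -> S) (mu : S -> \bar R) : Prop := SteadyStateLaw {
  steady_ge0 : forall x, 0 <= mu x;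
  steady_sum1 : \esum_(x in setT) mu x = 1;
  steady_stationary : stationary mu;
  steady_limit : forall x, law P (X t) x @[t --> \oo] --> mu x }.

End markov_chains.

Section switch.
Variable n : nat.

(* Subtraction on [nat] is truncated at 0, so that each entry is
   max {0, q_ij + a_ij - s_ij}. *)
Definition next_queue (q a s : 'M[nat]_n) : 'M[nat]_n :=
  \matrix_(i, j) (q i j + a i j - s i j)%N.

Context {d : measure_display} {T : measurableType d} {R : realType}.
Variable P : probability T R.
Implicit Types a s q : nat -> T -> 'M[nat]_n.

(* The pair (a(t), s(t)) has the same law for every t, so time 0 is used. *)
Definition switch_kernel a s (x y : 'M[nat]_n) : \bar R :=
  P [set w | next_queue x (a 0%N w) (s 0%N w) = y].

Definition switch_states a s : set 'M[nat]_n :=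
  [set x | reachable (switch_kernel a s) (0%R : 'M[nat]_n) x].

Definition queue_total (x : 'M[nat]_n) : nat := (\sum_i \sum_j x i j)%N.

Definition arrival_entry a (i j : 'I_n) (t : nat) (w : T) : nat := a t w i j.

Definition arrival_real a (i j : 'I_n) (t : nat) (w : T) : R :=
  (a t w i j)%:R%R.

Record arrival_process (amax : nat) (lambda : 'M[R]_n) a : Prop :=
    ArrivalProcess {
  arrival_rv : forall t, discrete_rv (a t);
  arrival_indep_time : forall i j,
    mutually_independent P (arrival_entry a i j);
  arrival_same_law : forall i j,
    identically_distributed P (arrival_entry a i j);
  (* Independence of the n^2 processes is independence of all their finite
     initial segments. *)
  arrival_indep_pairs : forall t,
    mutually_independent P
      (fun ij : 'I_n * 'I_n => history (arrival_entry a ij.1 ij.2) t);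
  arrival_bounded : forall t w i j, (a t w i j <= amax)%N;
  arrival_zero : forall t, 0 < P (a t @^-1` [set 0%R]);
  arrival_mean : forall t i j,
    'E_P[arrival_real a i j t] = (lambda i j)%:E }.

Record random_scheduling a s q : Prop := RandomScheduling {
  schedule_rv : forall t, discrete_rv (s t);
  schedule_perm : forall t w, is_perm_mx (s t w);
  schedule_uniform : forall t (p : 'S_n),
    law P (s t) (perm_mx p) = ((n`!)%:R^-1)%R%:E;
  schedule_indep_past : forall t,
    independent_rvs P (s t)
      (fun w => (history q t.+1 w, history a t w, history s t w)) }.

Record switch_system (amax : nat) (lambda : 'M[R]_n) a s q : Prop :=
    SwitchSystem {
  switch_arrivals : arrival_process amax lambda a;
  switch_schedules : random_scheduling a s q;
  switch_arrivals_indep : forall t,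
    independent_rvs P (a t) (fun w => (history q t.+1 w, history s t.+1 w));
  switch_init_rv : discrete_rv (q 0%N);
  switch_init : P (q 0%N @^-1` switch_states a s) = 1;
  switch_evolution : forall t w, q t.+1 w = next_queue (q t w) (a t w) (s t w) }.

Definition bernoulli_arrivals (p : R) a :=
  forall t i j,
    law P (arrival_entry a i j t) 1%N = p%:E /\
    law P (arrival_entry a i j t) 0%N = (1 - p)%R%:E.

End switch.

Definition frobenius_norm {R : realType} {m n : nat} (A : 'M[R]_(m, n)) : R :=
  Num.sqrt (\sum_i \sum_j A i j ^+ 2)%R.

(* Main.v *)
Require Import Defs.
From HB Require Import structures.
From mathcomp Require Import all_boot all_order all_algebra all_fingroup finmap.
From mathcomp Require Import all_classical all_reals all_analysis.
From mathcomp Require Import measurable_realfun.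
From mathcomp Require Import ring lra zify.

(** Write the dynamics as q(t+1) = F (q(t)) (om(t)), where the noise om(t) (the
    arrivals and the permutation used in slot t) takes finitely many values and
    is independent of the past. Everything about the chain is then read off the
    transfer operator U f x = E [f (F x om)], a finite sum.

    Contraction. Fix z > 1 and let d(x, y) be the sum over the entries of
    |z^x_ij - z^y_ij| / (z - 1). Run two copies of the switch with the same
    noise. In the coordinate z^x an entry evolves by u |-> max(1, z^(a-s) u),
    which is Lipschitz with constant z^(a-s); since E (a - s) = - eps / n < 0,
    one has E z^(a-s) < 1 for z close to 1. So U contracts d-Lipschitz functions
    ([switch_map_contract], [switch_contractive]). The distance between distinct
    states is at least 1, so indicators of states are d-Lipschitz, and U^t f
    converges pointwise, geometrically fast, to a constant, [limit_mean f]
    ([cvg_iter_transfer]). Its values on indicators form the stationary law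
    [limit_law]; no mass escapes because the drift bounds exponential moments
    ([esum_limit_law]). The law of q(t) converges to it from any initial law by
    dominated convergence ([driven_law_cvg]).

    Positive recurrence. From any state, the event that nothing arrives while the
    schedules serve nonempty queues has positive probability and leads to 0, from
    which every state of the chain is reachable. Together with the drift of
    d(x, 0) this gives a Lyapunov function for the chain killed at y, whose values
    bound the expected hitting times of y ([survival_sum_le]).

    Mean queue length. For c = a + 1 - s one has x' (x' + 1) = (x + c)(x + c - 1)
    with no boundary term: when x + a < s both sides vanish. Hence the quadratic
    function Q(x), the sum of x_ij (x_ij + 1), satisfies
      U Q = Q - 2 (eps / n) total + M,   M = the sum of E [c_ij (c_ij - 1)],
    and averaging over the stationary law gives E [total] = n M / (2 eps)
    ([queue_quad_transfer], [switch_mean_queue]). This is exact for every eps; as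
    eps tends to 0, M tends to the sum of the limit variances plus n - 1. For
    Bernoulli arrivals the variances are lambda - lambda^2, and the limit
    simplifies. *)

Set Implicit Arguments.
Unset Strict Implicit.

Import Order.TTheory GRing.Theory Num.Theory.
Import numFieldNormedType.Exports.

Local Open Scope classical_set_scope.
Local Open Scope ring_scope.

(** * Contraction of the transfer operator *)

Section transfer_operator.
Context {R : realType} {S : countType} {W : finType}.
Context (w : W -> R) (F : S -> W -> S).
Implicit Types (f g : S -> R) (x y : S).

Definition transfer f x : R := \sum_om w om * f (F x om).

Definition iter_transfer (t : nat) f : S -> R := iter t transfer f.

Definition point_mass y x : R := (x == y)%:R.

(** The two mechanisms behind ergodicity. [mean_contract] is contraction in mean
    of two copies run with the same noise; [dist_ge1] turns closeness into
    equality. [N] is a size with finite sublevel sets, at most a multiple of the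
    square root of 1 + d x o, that some noise value of probability at least [k]
    decreases unless it is 0: this gives tightness and access to [o]. *)
Record contractive_iteration (d : S -> S -> R) (o : S) (N : S -> nat)
    (g C k : R) : Prop := ContractiveIteration {
  noise_ge0 : forall om, 0 <= w om;
  noise_sum1 : \sum_om w om = 1;
  dist_ge0 : forall x y, 0 <= d x y;
  dist_ge1 : forall x y, x != y -> 1 <= d x y;
  dist_sym : forall x y, d x y = d y x;
  dist_triangle : forall x y z, d x z <= d x y + d y z;
  rate_ge0 : 0 <= g;
  rate_lt1 : g < 1;
  mean_contract : forall x y, \sum_om w om * d (F x om) (F y om) <= g * d x y;
  size_le : forall x, (N x)%:R ^+ 2 <= C * (1 + d x o);
  size_finite : forall L, finite_set [set x | (N x <= L)%N];
  size0_origin : forall x, N x = 0%N -> x = o;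
  drain_gt0 : 0 < k;
  drain : forall x, exists2 om, k <= w om & (N (F x om) <= (N x).-1)%N }.

Definition dist_lipschitz (d : S -> S -> R) (L : R) f :=
  0 <= L /\ forall x y, `|f x - f y| <= L * d x y.

(** The stationary mean of [f]; the starting point [o] is immaterial for
    Lipschitz [f]. *)
Definition limit_mean (o : S) f : R := limn (fun t => iter_transfer t f o).

Context (d : S -> S -> R) (o : S) (N : S -> nat) (g C k : R).
Hypothesis H : contractive_iteration d o N g C k.

Lemma transfer_le f h x : (forall y, f y <= h y) -> transfer f x <= transfer h x.
Proof. by move=> fh; apply: ler_sum => om _; rewrite ler_wpM2l ?(noise_ge0 H). Qed.

Lemma transferD f h x : transfer (f \+ h) x = transfer f x + transfer h x.
Proof. by rewrite /transfer -big_split; apply: eq_bigr => om _; rewrite mulrDr. Qed.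

Lemma transferZ c f x : transfer (fun y => c * f y) x = c * transfer f x.
Proof. by rewrite /transfer big_distrr; apply: eq_bigr => om _; rewrite mulrCA. Qed.

Lemma transfer_cst c x : transfer (fun=> c) x = c.
Proof. by rewrite /transfer -big_distrl /= (noise_sum1 H) mul1r. Qed.

Lemma transfer_ge0 f x : (forall y, 0 <= f y) -> 0 <= transfer f x.
Proof. by move=> f0; apply: sumr_ge0 => om _; rewrite mulr_ge0 ?(noise_ge0 H). Qed.

Lemma iter_transfer_le t f h x : (forall y, f y <= h y) ->
  iter_transfer t f x <= iter_transfer t h x.
Proof. by move=> fh; elim: t x => //= t IH x; exact: transfer_le. Qed.

Lemma iter_transferD t f h x :
  iter_transfer t (f \+ h) x = iter_transfer t f x + iter_transfer t h x.
Proof.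
elim: t x => //= t IH x; rewrite -transferD; congr transfer.
by apply/funext => y; exact: IH.
Qed.

Lemma iter_transferZ t c f x :
  iter_transfer t (fun y => c * f y) x = c * iter_transfer t f x.
Proof.
elim: t x => //= t IH x; rewrite -transferZ; congr transfer.
by apply/funext => y; exact: IH.
Qed.

Lemma iter_transfer_cst t c x : iter_transfer t (fun=> c) x = c.
Proof.
elim: t x => //= t IH x; rewrite -[RHS](transfer_cst _ x); congr transfer.
by apply/funext => y; exact: IH.
Qed.

Lemma iter_transfer_ge0 t f x : (forall y, 0 <= f y) -> 0 <= iter_transfer t f x.
Proof. by move=> f0; rewrite -(iter_transfer_cst t 0 x); exact: iter_transfer_le. Qed.

Lemma dist_lipschitz_transfer L f :
  dist_lipschitz d L f -> dist_lipschitz d (L * g) (transfer f).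
Proof.
move=> [L0 Lf]; split=> [|x y]; first by rewrite mulr_ge0 ?(rate_ge0 H).
rewrite -sumrB (le_trans (ler_norm_sum _ _ _))// -mulrA.
apply: le_trans (ler_wpM2l L0 (mean_contract H x y)).
rewrite big_distrr/=; apply: ler_sum => om _.
rewrite -mulrBr normrM ger0_norm ?(noise_ge0 H)// mulrCA.
by rewrite ler_wpM2l ?(noise_ge0 H).
Qed.

Lemma dist_lipschitz_iter t L f :
  dist_lipschitz d L f -> dist_lipschitz d (L * g ^+ t) (iter_transfer t f).
Proof.
move=> Lf; elim: t => [|t IH]; first by rewrite expr0 mulr1.
by rewrite exprSr mulrA; exact: dist_lipschitz_transfer.
Qed.

Lemma rate_norm : `|g| < 1.
Proof. by rewrite ger0_norm ?(rate_ge0 H)// (rate_lt1 H). Qed.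

Lemma dist_lipschitz_indic A : dist_lipschitz d 1 (\1_A).
Proof.
split=> // x y; rewrite mul1r; have [->|xy] := eqVneq x y.
  by rewrite subrr normr0 (dist_ge0 H).
apply: le_trans (dist_ge1 H xy); rewrite !indicE.
by case: (_ \in _); case: (_ \in _); rewrite ?subrr ?subr0 ?sub0r ?normrN ?normr0 ?normr1.
Qed.

Lemma dist_lipschitz_point_mass y : dist_lipschitz d 1 (point_mass y).
Proof.
have -> : point_mass y = \1_[set y]; last exact: dist_lipschitz_indic.
apply/funext => x; rewrite indicE /point_mass; congr ((nat_of_bool _)%:R).
by apply/eqP/idP => [->|/set_mem//]; exact: mem_set.
Qed.

Lemma dist_lipschitzV : dist_lipschitz d 1 (d^~ o).
Proof.
split=> // x y; rewrite mul1r ler_norml; have := dist_triangle H x y o.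
by have := dist_triangle H y x o; rewrite (dist_sym H y x); lra.
Qed.

Lemma dist_lipschitz_cst c : dist_lipschitz d 0 (fun=> c).
Proof. by split=> // x y; rewrite subrr normr0 mul0r. Qed.

Lemma dist_lipschitzD L L' f h : dist_lipschitz d L f -> dist_lipschitz d L' h ->
  dist_lipschitz d (L + L') (f \+ h).
Proof.
move=> [L0 Lf] [L'0 Lh]; split=> [|x y]; first exact: addr_ge0.
rewrite /= opprD addrACA mulrDl (le_trans (ler_normD _ _))//.
by rewrite lerD ?Lf ?Lh.
Qed.

Lemma dist_lipschitzZ c L f : dist_lipschitz d L f ->
  dist_lipschitz d (`|c| * L) (fun x => c * f x).
Proof.
move=> [L0 Lf]; split=> [|x y]; first by rewrite mulr_ge0.
by rewrite -mulrBr normrM -mulrA ler_wpM2l ?Lf.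
Qed.

(** U^(t+1) f (o) - U^t f (o) is the mean of U^t f (F o om) - U^t f (o), which is
    at most a multiple of g^t: the iterates are Cauchy. *)
Lemma is_cvg_iter_transfer L f : dist_lipschitz d L f ->
  cvgn (fun t => iter_transfer t f o).
Proof.
move=> Lf; set u := fun t => _.
rewrite (_ : u = cst (u 0%N) \+ series (telescope u)); last first.
  by apply/funext => t; rewrite {1}(eq_sum_telescope u t).
apply: is_cvgD; first exact: is_cvg_cst.
apply: normed_cvg.
pose A := L * \sum_om w om * d (F o om) o.
apply: (@series_le_cvg _ _ (geometric A g)) => [t|t|t|] /=.
- exact: normr_ge0.
- rewrite mulr_ge0 ?exprn_ge0 ?(rate_ge0 H)// mulr_ge0 ?(proj1 Lf)//.
  by apply: sumr_ge0 => om _; rewrite mulr_ge0 ?(noise_ge0 H) ?(dist_ge0 H).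
- have [_ Lt] := dist_lipschitz_iter t Lf.
  rewrite /telescope/= /u /= -(iter_transfer_cst 1 (iter_transfer t f o) o)/=.
  rewrite -sumrB (le_trans (ler_norm_sum _ _ _))//.
  rewrite /A mulrAC big_distrr/=; apply: ler_sum => om _.
  rewrite -mulrBr normrM ger0_norm ?(noise_ge0 H)// mulrCA.
  by rewrite ler_wpM2l ?(noise_ge0 H).
- exact: is_cvg_geometric_series rate_norm.
Qed.

Lemma cvg_iter_transfer L f x : dist_lipschitz d L f ->
  iter_transfer t f x @[t --> \oo] --> limit_mean o f.
Proof.
move=> Lf.
have u0 : iter_transfer t f o @[t --> \oo] --> limit_mean o f.
  exact: is_cvg_iter_transfer Lf.
rewrite -[limit_mean _ _]add0r.
rewrite (_ : (fun t => _) = (fun t => iter_transfer t f x - iter_transfer t f o)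
  \+ (fun t => iter_transfer t f o)); last by apply/funext => t /=; rewrite subrK.
apply: cvgD => //; apply/norm_cvg0P.
have h : geometric (L * d x o) g @ \oo --> 0 by exact: cvg_geometric rate_norm.
apply: squeeze_cvgr (cvg_cst 0) h; apply: nearW => t.
rewrite normr_ge0/= mulrAC; exact: (dist_lipschitz_iter t Lf).2.
Qed.

Lemma limit_mean_le L L' f h : dist_lipschitz d L f -> dist_lipschitz d L' h ->
  (forall x, f x <= h x) -> limit_mean o f <= limit_mean o h.
Proof.
move=> /is_cvg_iter_transfer Lf /is_cvg_iter_transfer Lh fh.
by apply: ler_lim => //; apply: nearW => t; exact: iter_transfer_le.
Qed.

Lemma limit_mean_cst c : limit_mean o (fun=> c) = c.
Proof.
rewrite /limit_mean (_ : (fun t => _) = cst c) ?lim_cst//.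
by apply/funext => t; rewrite iter_transfer_cst.
Qed.

(** Invariance of the stationary mean: applying the operator shifts the sequence
    of iterates by one. *)
Lemma limit_mean_transfer L f : dist_lipschitz d L f ->
  limit_mean o (transfer f) = limit_mean o f.
Proof.
move=> /is_cvg_iter_transfer Lf.
have -> : limit_mean o (transfer f) = limn (fun t => iter_transfer t.+1 f o).
  by congr (lim (_ @ \oo)); apply/funext => t; rewrite /iter_transfer iterSr.
by apply/cvg_lim => //; rewrite (cvg_shiftS (fun t => iter_transfer t f o)).
Qed.

Lemma limit_meanD L L' f h : dist_lipschitz d L f -> dist_lipschitz d L' h ->
  limit_mean o (f \+ h) = limit_mean o f + limit_mean o h.
Proof.
move=> /is_cvg_iter_transfer Lf /is_cvg_iter_transfer Lh.
rewrite /limit_mean -limD//; congr (lim (_ @ \oo)).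
by apply/funext => t; rewrite iter_transferD.
Qed.

Lemma limit_meanZ L c f : dist_lipschitz d L f ->
  limit_mean o (fun x => c * f x) = c * limit_mean o f.
Proof.
move=> /is_cvg_iter_transfer Lf.
apply/cvg_lim => //.
rewrite (_ : (fun t => _) = (fun t => c * iter_transfer t f o)); last first.
  by apply/funext => t; rewrite iter_transferZ.
by apply: cvgM; [exact: cvg_cst|exact: Lf].
Qed.

End transfer_operator.

(** * The limit law *)

Section limit_law.
Context {R : realType} {S : countType} {W : finType}.
Context (w : W -> R) (F : S -> W -> S).
Context (d : S -> S -> R) (o : S) (N : S -> nat) (g C k : R).
Hypothesis H : contractive_iteration w F d o N g C k.

Definition limit_law (y : S) : \bar R := (limit_mean w F o (point_mass y))%:E.

Lemma limit_law_ge0 y : (0 <= limit_law y)%E.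
Proof.
rewrite lee_fin -(limit_mean_cst H 0).
apply: (limit_mean_le H (dist_lipschitz_cst d 0) (dist_lipschitz_point_mass H y)).
by move=> x; exact: ler0n.
Qed.

Lemma limit_mean_finite_sum (s : seq S) (f : S -> R) :
  (exists L, dist_lipschitz d L (fun x => \sum_(y <- s) f y * point_mass y x)) /\
  limit_mean w F o (fun x => \sum_(y <- s) f y * point_mass y x) =
    \sum_(y <- s) f y * limit_mean w F o (point_mass y).
Proof.
elim: s => [|y s [[L [L0 Ls]] IH]].
  rewrite big_nil (_ : (fun x => _) = (fun=> 0)); last first.
    by apply/funext => x; rewrite big_nil.
  split; last exact: (limit_mean_cst H 0).
  by exists 0; exact: dist_lipschitz_cst d _.
have Ly := dist_lipschitzZ (f y) (dist_lipschitz_point_mass H y).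
rewrite big_cons (_ : (fun x => _) = (fun x => f y * point_mass y x) \+
  (fun x => \sum_(z <- s) f z * point_mass z x)); last first.
  by apply/funext => x; rewrite big_cons.
split.
  by exists (`|f y| * 1 + L); exact: dist_lipschitzD Ly (conj L0 Ls).
rewrite -IH -(limit_meanZ H _ (dist_lipschitz_point_mass H y)).
exact: (limit_meanD H Ly (conj L0 Ls)).
Qed.

Lemma sum_point_mass (s : seq S) (f : S -> R) x : uniq s ->
  \sum_(y <- s) f y * point_mass y x = if x \in s then f x else 0.
Proof.
move=> us; have [xs|xs] := ifPn; last first.
  rewrite big_seq big1// => y ys; rewrite /point_mass.
  by case: eqVneq => [xy|_]; [rewrite xy ys in xs|rewrite mulr0].
rewrite (bigD1_seq x)//= /point_mass eqxx mulr1 big1 ?addr0// => y yx.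
by rewrite eq_sym (negbTE yx) mulr0.
Qed.

(** The stationary mean is integration against the limit law: mass could only be
    lost at infinity, but on N > M the bound on [f] and the domination of N^2 by
    the distance V to [o] give f <= 2 c C (1 + V) / M, and V has a finite
    stationary mean. *)
Lemma esum_limit_law L c (f : S -> R) : dist_lipschitz d L f ->
  (forall x, 0 <= f x <= c * (1 + (N x)%:R)) ->
  \esum_(x in [set: S]) (limit_law x * (f x)%:E)%E = (limit_mean w F o f)%:E.
Proof.
move=> Lf f0c.
have f0 x : 0 <= f x by case/andP: (f0c x).
have fc x : f x <= c * (1 + (N x)%:R) by case/andP: (f0c x).
have c0 : 0 <= c.
  by rewrite -(pmulr_lge0 c (_ : 0 < 1 + (N o)%:R)) ?(le_trans (f0 o))// ltr_wpDr.
have finE (X : {fset S}) : (\sum_(x <- X) limit_law x * (f x)%:E)%E =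
    (limit_mean w F o (fun x => if x \in X then f x else 0))%:E.
  have [_ e] := limit_mean_finite_sum X f.
  transitivity ((\sum_(y <- X) f y * limit_mean w F o (point_mass y))%:E).
    by rewrite -sumEFin; apply: eq_bigr => x _; rewrite /limit_law -EFinM mulrC.
  rewrite -e; congr (_%:E); congr limit_mean; apply/funext => x.
  by rewrite sum_point_mass ?fset_uniq.
have LipX (X : {fset S}) :
    exists L', dist_lipschitz d L' (fun x => if x \in X then f x else 0).
  have [[L' LL] _] := limit_mean_finite_sum X f; exists L'.
  rewrite (_ : (fun x => _) = (fun x => \sum_(y <- X) f y * point_mass y x))//.
  by apply/funext => x; rewrite sum_point_mass ?fset_uniq.
apply/eqP; rewrite eq_le; apply/andP; split.
  rewrite ge_ereal_sup => //= _ [X [finX _]] <-.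
  rewrite fsbig_finite//= finE lee_fin.
  have [L' LX] := LipX (fset_set X).
  by apply: (limit_mean_le H LX Lf) => x; case: ifP.
apply/lee_addgt0Pr => e e0.
set V := fun x => d x o.
have LV : dist_lipschitz d 1 V := dist_lipschitzV H.
pose B := 2 * c * (C * (1 + limit_mean w F o V)).
have C1 x : 0 <= C * (1 + V x) by apply: le_trans (size_le H x); rewrite exprn_ge0.
have V0 x : 0 <= V x := dist_ge0 H x o.
have C0 : 0 <= C by rewrite -(pmulr_lge0 C (_ : 0 < 1 + V o)) ?C1// ltr_wpDr.
have PV0 : 0 <= limit_mean w F o V.
  rewrite -(limit_mean_cst H 0).
  exact: (limit_mean_le H (dist_lipschitz_cst d 0) LV).
have B0 : 0 <= B / e.
  by rewrite divr_ge0 ?(ltW e0)// mulr_ge0 ?mulr_ge0// addr_ge0.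
pose M := Num.bound (B / e).
have Mgt : B / e < M%:R := archi_boundP B0.
have M0 : 0 < M%:R :> R := le_lt_trans B0 Mgt.
pose X := fset_set [set x | (N x <= M)%N].
have XE x : (x \in X) = (N x <= M)%N.
  rewrite in_fset_set; last exact: (size_finite H).
  by apply/idP/idP => [/set_mem//|xM]; exact: mem_set.
apply: (@le_trans _ _ ((\sum_(x <- X) limit_law x * (f x)%:E)%E + e%:E)%E); last first.
  rewrite leeD2r// esum_ge//; exists [set` X] => //.
  by rewrite -fsbig_seq// fset_uniq.
rewrite finE -EFinD lee_fin.
have [L' LX] := LipX X.
pose q := 2 * c * C / M%:R.
have q0 : 0 <= q by rewrite divr_ge0 ?(ltW M0)// !mulr_ge0.
have L1V := dist_lipschitzD (dist_lipschitz_cst d 1) LV.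
have Lq := dist_lipschitzZ q L1V.
have Lsum := dist_lipschitzD LX Lq.
apply: (@le_trans _ _ (limit_mean w F o
    ((fun x => if x \in X then f x else 0) \+ (fun x => q * (1 + V x))))).
  apply: (limit_mean_le H Lf Lsum) => x /=; rewrite XE.
  case: leqP => [_|Nx]; first by rewrite lerDl mulr_ge0// addr_ge0.
  rewrite add0r (le_trans (fc x))//.
  have N1 : 1 <= (N x)%:R :> R by rewrite ler1n (leq_ltn_trans _ Nx).
  have NM : M%:R <= (N x)%:R :> R by rewrite ler_nat ltnW.
  rewrite /q mulrAC ler_pdivlMr// -!mulrA.
  apply: (@le_trans _ _ (2 * (c * (N x)%:R ^+ 2))).
    rewrite (mulrCA 2) ler_wpM2l//.
    nra.
  by rewrite ler_wpM2l// ler_wpM2l// (size_le H).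
rewrite (limit_meanD H LX Lq) lerD2l.
rewrite (limit_meanZ H _ L1V) (limit_meanD H (dist_lipschitz_cst d 1) LV).
rewrite (limit_mean_cst H) /q.
have -> : 2 * c * C / M%:R * (1 + limit_mean w F o V) = B / M%:R.
  by rewrite /B mulrAC !mulrA.
by rewrite ler_pdivrMr// mulrC -ler_pdivrMr// ltW.
Qed.

Lemma limit_law_sum1 : \esum_(x in [set: S]) limit_law x = 1%E.
Proof.
rewrite -(limit_mean_cst H 1) -(esum_limit_law (dist_lipschitz_cst d 1) (c := 1)).
  by apply: eq_esum => x _; rewrite mule1.
by move=> x; rewrite ler01 mul1r lerDl ler0n.
Qed.

Lemma limit_law_transfer y :
  \esum_(x in [set: S]) (limit_law x * (transfer w F (point_mass y) x)%:E)%E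
  = limit_law y.
Proof.
have Ly := dist_lipschitz_point_mass H y.
rewrite (esum_limit_law (dist_lipschitz_transfer H Ly) (c := 1)).
  by rewrite (limit_mean_transfer H Ly).
move=> x; rewrite (transfer_ge0 H)/=; last by move=> z; exact: ler0n.
rewrite mul1r (@le_trans _ _ 1) ?lerDl ?ler0n//.
rewrite -(transfer_cst H 1 x); apply: (transfer_le H) => z.
by rewrite /point_mass; case: eqP => _; rewrite ?lexx.
Qed.

End limit_law.

(** * Positive recurrence *)

Section recurrence.
Context {R : realType} {S : countType} {W : finType}.
Context (w : W -> R) (F : S -> W -> S).
Context (d : S -> S -> R) (o : S) (N : S -> nat) (g C k : R).
Hypothesis H : contractive_iteration w F d o N g C k.

(** The transfer operator of the chain killed on reaching [y]. *)
Definition avoiding (y : S) (f : S -> R) : S -> R :=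
  transfer w F (fun z => (z != y)%:R * f z).

(** The probability of not visiting [y] at the times 1, ..., [m]. *)
Definition survival (y : S) (m : nat) : S -> R := iter m (avoiding y) (fun=> 1).

Lemma avoiding_le y f h x : (forall z, f z <= h z) ->
  avoiding y f x <= avoiding y h x.
Proof. by move=> fh; apply: (transfer_le H) => z; rewrite ler_wpM2l. Qed.

Lemma avoiding_le_transfer y f x : (forall z, 0 <= f z) ->
  avoiding y f x <= transfer w F f x.
Proof.
move=> f0; apply: (transfer_le H) => z.
by case: (z == y); rewrite ?mul0r ?mul1r.
Qed.

Lemma avoidingD y f h x :
  avoiding y (f \+ h) x = avoiding y f x + avoiding y h x.
Proof.
rewrite /avoiding -transferD; congr transfer.
by apply/funext => z /=; rewrite mulrDr.
Qed.

Lemma avoidingZ y c f x :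
  avoiding y (fun z => c * f z) x = c * avoiding y f x.
Proof.
rewrite /avoiding -transferZ; congr transfer.
by apply/funext => z /=; rewrite mulrCA.
Qed.

Lemma survival_ge0 y m x : 0 <= survival y m x.
Proof.
elim: m x => //= m IH x; apply: (transfer_ge0 H) => z.
by rewrite mulr_ge0.
Qed.

Lemma survivalS_le y m x : survival y m.+1 x <= survival y m x.
Proof.
elim: m x => [|m IH] x; last by apply: avoiding_le; exact: IH.
by rewrite -[leRHS](transfer_cst H 1 x); exact: avoiding_le_transfer.
Qed.

Lemma survival_le1 y m x : survival y m x <= 1.
Proof. by elim: m x => // m IH x; exact: le_trans (survivalS_le _ _ _) (IH _). Qed.

(** Being at [y] at time [m.+1] excludes having avoided [y] until then. *)
Lemma survival_visit y m x :
  survival y m.+1 x + iter_transfer w F m.+1 (point_mass y) x <= 1.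
Proof.
have step n : (forall x, (x != y)%:R * survival y n x +
      iter_transfer w F n (point_mass y) x <= 1) ->
    forall x, survival y n.+1 x + iter_transfer w F n.+1 (point_mass y) x <= 1.
  move=> IH z; rewrite -[leRHS](transfer_cst H 1 z) /= -transferD.
  exact: (transfer_le H).
apply: (step) => {}x; elim: m x => [|m IH] x.
  by rewrite /= /point_mass; case: (x == y); rewrite /= ?(mul0r, mul1r, addr0, add0r).
apply: le_trans (step m IH x); rewrite lerD2r.
by case: (x == y); rewrite ?(mul0r, mul1r)// survival_ge0.
Qed.

Lemma drain_prob L x : (N x <= L)%N ->
  k ^+ L <= iter_transfer w F L (point_mass o) x.
Proof.
elim: L x => [|L IH] x NL.
  rewrite expr0 /= /point_mass (_ : x = o) ?eqxx//.
  by apply: (size0_origin H); apply/eqP; rewrite -leqn0.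
have [om kw Nx] := drain H x.
rewrite exprS /= /transfer (bigD1 om)//= -[leLHS]addr0 lerD//.
  rewrite ler_pM ?exprn_ge0 ?(ltW (drain_gt0 H))// IH//.
  by rewrite (leq_trans Nx)// -subn1 leq_subLR add1n.
apply: sumr_ge0 => i _; rewrite mulr_ge0 ?(noise_ge0 H)//.
by apply: (iter_transfer_ge0 H) => z; exact: ler0n.
Qed.

Lemma drain_visit L l x y : (N x <= L)%N ->
  k ^+ L * iter_transfer w F l (point_mass y) o <=
  iter_transfer w F (L + l) (point_mass y) x.
Proof.
move=> NL; set f := iter_transfer w F l _.
have -> : iter_transfer w F (L + l) (point_mass y) = iter_transfer w F L f.
  by rewrite /iter_transfer iterD.
have f0 z : 0 <= f z by apply: (iter_transfer_ge0 H) => u; exact: ler0n.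
rewrite mulrC; apply: le_trans (ler_wpM2l (f0 o) (drain_prob NL)) _.
rewrite -iter_transferZ; apply: (iter_transfer_le H) => z.
by rewrite /point_mass; case: eqP => [->|_]; rewrite ?mulr1 ?mulr0.
Qed.

Lemma transferV_le x : transfer w F (d^~ o) x <=
  g * d x o + transfer w F (d^~ o) o.
Proof.
apply: (le_trans _ (lerD (mean_contract H x o) (lexx (transfer w F (d^~ o) o)))).
rewrite -big_split /=; apply: ler_sum => om _; rewrite -mulrDr.
by rewrite ler_wpM2l ?(noise_ge0 H)// (dist_triangle H).
Qed.

(** The sums are partial sums of the mean hitting time of [y]. A Lyapunov
    function [B] such that the killed operator sends [B] below [B - 1] bounds
    them. The distance V to [o] decreases by 1 in mean except where N is at most
    L; there G, the first [m] terms of the sum, compensates, since the killed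
    operator sends G to G - 1 + (survival up to time m) and [y] is visited at
    time [m] with probability at least [h]. So B = V + c G with c h = b + 1. *)
Lemma survival_sum_le y l : 0 < iter_transfer w F l (point_mass y) o ->
  exists B : S -> R, forall m x, \sum_(0 <= j < m) survival y j x <= B x.
Proof.
set h0 := iter_transfer _ _ _ _ _ => h00.
pose V x := d x o.
have V0 x : 0 <= V x := dist_ge0 H x o.
pose b := transfer w F V o.
have b0 : 0 <= b by apply: (transfer_ge0 H).
have g1 : 0 < 1 - g by rewrite subr_gt0 (rate_lt1 H).
have C0 : 0 <= C.
  rewrite -(pmulr_lge0 C (_ : 0 < 1 + V o)) ?ltr_wpDr//.
  by apply: le_trans (size_le H o); rewrite exprn_ge0.
(* beyond this level the drift of V is at most - 1 *)
pose Rv := (b + 1) / (1 - g).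
have Rv0 : 0 <= Rv by rewrite divr_ge0 ?(ltW g1)// addr_ge0.
pose L := (Num.bound (C * (1 + Rv))).+1.
have NL x : (L < N x)%N -> Rv < V x.
  move=> LN; rewrite ltNge; apply/negP => VR.
  suff : (N x)%:R < L%:R :> R by rewrite ltr_nat ltnNge (ltnW LN).
  have N1 : 1 <= (N x)%:R :> R by rewrite ler1n (leq_ltn_trans _ LN).
  apply: (@le_lt_trans _ _ (C * (1 + Rv))).
    apply: (@le_trans _ _ ((N x)%:R ^+ 2)); first by nra.
    by apply: le_trans (size_le H x) _; rewrite ler_wpM2l// lerD2l.
  apply: (@lt_trans _ _ (Num.bound (C * (1 + Rv)))%:R).
    by rewrite archi_boundP// mulr_ge0// addr_ge0.
  by rewrite ltr_nat.
pose m := (L + l)%N.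
pose h := k ^+ L * h0.
have h_gt0 : 0 < h by rewrite mulr_gt0// exprn_gt0// (drain_gt0 H).
have sm x : (N x <= L)%N -> survival y m x <= 1 - h.
  move=> NxL; rewrite lerBrDr (le_trans _ (survival_visit y (L.-1 + l)%N x))//.
  by rewrite lerD2l; exact: drain_visit.
pose G x := \sum_(0 <= j < m) survival y j x.
have G0 x : 0 <= G x by apply: sumr_ge0 => j _; exact: survival_ge0.
have avoid_sum n x : avoiding y (fun z => \sum_(0 <= j < n) survival y j z) x =
    \sum_(0 <= j < n) survival y j.+1 x.
  elim: n => [|n IH].
    rewrite big_geq// (_ : (fun z => _) = (fun=> 0 * 1)) ?avoidingZ ?mul0r//.
    by apply/funext => z; rewrite big_geq// mul0r.
  rewrite big_nat_recr//= -IH -avoidingD; congr avoiding.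
  by apply/funext => z; rewrite big_nat_recr.
have avoidG x : avoiding y G x = G x - 1 + survival y m x.
  have e : G x + survival y m x = 1 + \sum_(0 <= j < m) survival y j.+1 x.
    by rewrite -big_nat_recr// big_nat_recl.
  by rewrite avoid_sum addrAC e addrAC subrr add0r.
pose c := (b + 1) / h.
have c0 : 0 <= c by rewrite divr_ge0 ?(ltW h_gt0)// addr_ge0.
pose B := V \+ (fun x => c * G x).
have B0 x : 0 <= B x by rewrite addr_ge0// mulr_ge0.
have drift x : avoiding y B x <= B x - 1.
  rewrite avoidingD avoidingZ avoidG.
  have Vx : avoiding y V x <= g * V x + b.
    by apply: le_trans (transferV_le x); apply: avoiding_le_transfer.
  rewrite (_ : B x = V x + c * G x)//; have [NxL|LNx] := leqP (N x) L.
    have : c * (G x - 1 + survival y m x) <= c * (G x - h).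
      by rewrite ler_wpM2l//; have := sm x NxL; lra.
    have ch : c * h = b + 1 by rewrite /c divfK// gt_eqF.
    have : g * V x <= V x by rewrite ler_piMl// ltW// (rate_lt1 H).
    by rewrite [c * (G x - h)]mulrBr ch; lra.
  have : c * (G x - 1 + survival y m x) <= c * G x.
    by rewrite ler_wpM2l//; have := survival_le1 y m x; lra.
  have : b + 1 <= V x * (1 - g) by rewrite -ler_pdivrMr// ltW// NL.
  by rewrite mulrBr mulr1 (mulrC (V x)); lra.
exists B; elim=> [|n IH] x; first by rewrite big_geq.
rewrite big_nat_recl// -avoid_sum.
have := avoiding_le y x IH; have := drift x.
by rewrite (_ : survival y 0 x = 1)//; lra.
Qed.

Context (K : S -> S -> \bar R).
Hypothesis KE : forall x y, K x y = (transfer w F (point_mass y) x)%:E.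

(** The bridge between the sums over the state space in the notions attached to
    a kernel and finite sums over the noise. *)
Lemma esum_kernel (D : set S) x f : (forall z, 0 <= f z) ->
  \esum_(z in D) (K x z * (f z)%:E)%E =
  (transfer w F (fun z => \1_D z * f z) x)%:E.
Proof.
move=> f0.
have -> : \esum_(z in D) (K x z * (f z)%:E)%E =
    \esum_(z in D) (\sum_om (w om * (point_mass z (F x om) * f z))%:E)%E.
  apply: eq_esum => z _; rewrite KE -EFinM sumEFin big_distrl/=; congr (_%:E).
  by apply: eq_bigr => om _; rewrite mulrA.
rewrite esum_sum; last first.
  by move=> z om _ _; rewrite lee_fin !mulr_ge0 ?(noise_ge0 H).
rewrite -sumEFin; apply: eq_bigr => om _; rewrite esum_mkcond.
rewrite (esumID [set F x om]); last first.
  by move=> z _; case: ifP => // _; rewrite lee_fin !mulr_ge0 ?(noise_ge0 H).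
rewrite setTI setTI esum_set1; last first.
  by case: ifP => // _; rewrite lee_fin !mulr_ge0 ?(noise_ge0 H).
rewrite [X in (_ + X)%E]esum1 ?adde0; last first.
  move=> z /= /eqP zF; case: ifP => // _.
  by rewrite /point_mass eq_sym (negbTE zF) mul0r mulr0.
rewrite indicE /point_mass eqxx mul1r; case: ifP => _ //.
  by rewrite mul1r.
by rewrite mul0r mulr0.
Qed.

Lemma first_passageE y m x :
  first_passage K y m x = (survival y m x - survival y m.+1 x)%:E.
Proof.
elim: m x => [|m IH] x.
  rewrite /= KE; congr (_%:E); apply/eqP; rewrite eq_sym subr_eq; apply/eqP.
  rewrite -[LHS](transfer_cst H 1 x) -transferD; congr transfer.
  apply/funext => z; rewrite /= /point_mass.
  by case: (z == y); rewrite /= ?mul0r ?mul1r ?addr0 ?add0r.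
transitivity (\esum_(z in ~` [set y])
    (K x z * (survival y m z - survival y m.+1 z)%:E)%E).
  by apply: eq_esum => z _; rewrite -IH.
rewrite esum_kernel; last by move=> z; rewrite subr_ge0 survivalS_le.
congr (_%:E); apply/eqP; rewrite eq_sym subr_eq; apply/eqP.
rewrite -transferD; congr transfer; apply/funext => z.
rewrite /= -[X in _ = _ + X](_ : (z != y)%:R * survival y m.+1 z = _)//.
rewrite indicE (_ : (z \in ~` [set y]) = (z != y)) -?mulrDr ?subrK//.
by apply/idP/idP => [/set_mem /eqP//|/eqP zy]; rewrite mem_set.
Qed.

(** Both series telescope: the first up to the survival probability, which tends
    to 0 as the terms of a convergent series; the second, by Abel summation, to
    partial sums of the survival probabilities. *)
Lemma positive_recurrent_of_visit y l :
  0 < iter_transfer w F l (point_mass y) o -> positive_recurrent_state K y.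
Proof.
move=> /survival_sum_le[B Bs].
have sum_fp n : (\sum_(0 <= j < n) first_passage K y j y)%E =
    (1 - survival y n y)%:E.
  under eq_bigr do rewrite first_passageE.
  rewrite sumEFin; congr (_%:E); elim: n => [|n IH].
    by rewrite big_geq// subrr.
  by rewrite big_nat_recr//= IH addrA subrK.
have sum_kfp n : (\sum_(0 <= j < n) j.+1%:R%:E * first_passage K y j y)%E =
    (\sum_(0 <= j < n) survival y j y - n%:R * survival y n y)%:E.
  under eq_bigr do rewrite first_passageE -EFinM.
  rewrite sumEFin; congr (_%:E); elim: n => [|n IH].
    by rewrite !big_geq// mul0r subrr.
  by rewrite !big_nat_recr//= IH -[n.+1%:R]natr1; ring.
have fp0 j : (0 <= first_passage K y j y)%E.
  by rewrite first_passageE lee_fin subr_ge0 survivalS_le.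
split.
  apply/cvg_lim => //.
  rewrite (_ : (fun n => _) = (fun n => (1 - survival y n y)%:E)); last first.
    by apply/funext => n; exact: sum_fp.
  apply: cvg_EFin; first exact: nearW.
  rewrite [X in X @ _ --> _](_ : _ = (fun n => 1 - survival y n y))//.
  rewrite -[X in _ --> X](subr0 1); apply: cvgB; first exact: cvg_cst.
  apply: (@cvg_series_cvg_0 _ _ (fun n => survival y n y)).
  apply: nondecreasing_is_cvgn.
    by apply/nondecreasing_seqP => n; rewrite /series/= big_nat_recr//= lerDl survival_ge0.
  by exists (B y) => _ [n _ <-]; exact: Bs.
apply: (@le_lt_trans _ _ (B y)%:E); last exact: ltry.
apply: lime_le.
  by apply: is_cvg_nneseries => j _ _; rewrite mule_ge0.
apply: nearW => n; rewrite sum_kfp lee_fin (le_trans _ (Bs n y))//.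
by rewrite lerBlDr lerDl mulr_ge0// survival_ge0.
Qed.

Lemma reachable_visit y : reachable K o y ->
  exists l, 0 < iter_transfer w F l (point_mass y) o.
Proof.
suff gen p x : path (fun u v => 0 < K u v)%E x p ->
    exists l, 0 < iter_transfer w F l (point_mass (last x p)) x.
  by move=> [p /gen + ->].
elim: p x => [|z p IH] x /=.
  by move=> _; exists 0%N; rewrite /= /point_mass eqxx.
move=> /andP[Kxz /IH[l hl]].
exists l.+1; rewrite /=; set f := iter_transfer _ _ _ _ in hl *.
rewrite KE lte_fin in Kxz.
apply: (lt_le_trans (mulr_gt0 hl Kxz)).
rewrite -transferZ; apply: (transfer_le H) => u.
rewrite /point_mass; case: eqP => [->|_]; rewrite ?mulr1 ?mulr0//.
by apply: (iter_transfer_ge0 H) => v; exact: ler0n.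
Qed.

Lemma positive_recurrent_reachable :
  positive_recurrent K [set y | reachable K o y].
Proof.
by move=> y Dy; have [l ?] := reachable_visit Dy; exact: (@positive_recurrent_of_visit y l).
Qed.

Lemma kernel_sum_reachable x : reachable K o x ->
  \esum_(y in [set y | reachable K o y]) K x y = 1%E.
Proof.
move=> [p px xl].
transitivity (\esum_(y in [set y | reachable K o y]) (K x y * (1%R)%:E)%E).
  by apply: eq_esum => y _; rewrite mule1.
rewrite esum_kernel//; congr (_%:E); rewrite -[RHS](transfer_cst H 1 x).
apply: eq_bigr => om _.
have := noise_ge0 H om; rewrite le_eqVlt => /orP[/eqP <-|wom].
  by rewrite !mul0r.
suff xF : reachable K o (F x om) by rewrite indicE mem_set// !mulr1.
exists (rcons p (F x om)); last by rewrite last_rcons.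
rewrite rcons_path px /= -xl KE lte_fin /transfer (bigD1 om)//= /point_mass eqxx.
rewrite mulr1 ltr_wpDr// sumr_ge0// => i _.
by rewrite mulr_ge0 ?(noise_ge0 H).
Qed.

End recurrence.

(** * Chains driven by independent noise *)

Section discrete_random_variables.
Context {disp : measure_display} {T : measurableType disp} {R : realType}.
Context (P : probability T R).
Local Open Scope ereal_scope.

Lemma discrete_rv_preimage {E : countType} (X : T -> E) (A : set E) :
  discrete_rv X -> measurable (X @^-1` A).
Proof.
move=> mX; rewrite (_ : X @^-1` A =
    \bigcup_(x : E) (if x \in A then X @^-1` [set x] else set0)).
  apply: countable_bigcupT_measurable => // x.
  by case: ifP => // _; exact: mX.
apply/seteqP; split=> [t At|t [x _]].
  by exists (X t) => //; rewrite mem_set.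
by case: ifP => // /set_mem Ax /= Xt; rewrite /preimage /= Xt.
Qed.

Lemma discrete_rv_comp {E E' : countType} (X : T -> E) (f : E -> E') :
  discrete_rv X -> discrete_rv (f \o X).
Proof.
by move=> mX y; rewrite comp_preimage; exact: discrete_rv_preimage.
Qed.

Lemma discrete_rv_pair {E E' : countType} (X : T -> E) (Y : T -> E') :
  discrete_rv X -> discrete_rv Y -> discrete_rv (fun t => (X t, Y t)).
Proof.
move=> mX mY [x y]; rewrite (_ : _ @^-1` _ = X @^-1` [set x] `&` Y @^-1` [set y]).
  exact: measurableI.
by apply/seteqP; split=> t /= [-> ->].
Qed.

Lemma historyS {E : Type} (X : nat -> T -> E) m om :
  history X m.+1 om = rcons (history X m om) (X m om).
Proof. by rewrite /history -addn1 iotaD map_cat cats1. Qed.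

Lemma discrete_rv_history {E : countType} (X : nat -> T -> E) m :
  (forall j, discrete_rv (X j)) -> discrete_rv (history X m).
Proof.
move=> mX; elim: m => [|m IH].
  move=> l; rewrite (_ : _ @^-1` _ = if l is [::] then setT else set0).
    by case: l.
  by rewrite /history /=; apply/seteqP; case: l; split.
rewrite (_ : history X m.+1 = (fun p => rcons p.1 p.2) \o
    (fun t => (history X m t, X m t))).
  exact/discrete_rv_comp/discrete_rv_pair.
by apply/funext => t; exact: historyS.
Qed.

Lemma discrete_rv_measurable_fun {E : countType} (X : T -> E) (f : E -> \bar R) :
  discrete_rv X -> measurable_fun setT (fun t => f (X t)).
Proof.
move=> mX _ Y _; rewrite setTI (_ : _ @^-1` _ = X @^-1` (f @^-1` Y))//.
exact: discrete_rv_preimage.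
Qed.

(** The fibres of [X], numbered by an encoding of [E] in the natural numbers,
    partition the probability space, and the integrand is constant on each. *)
Lemma integral_discrete_rv {E : countType} (X : T -> E) (f : E -> R) :
  discrete_rv X -> (forall x, (0 <= f x)%R) ->
  \int[P]_t (f (X t))%:E = \esum_(x in [set: E]) (law P X x * (f x)%:E).
Proof.
move=> mX f0.
pose G (k : nat) : set T :=
  if pickle_inv k is Some x then X @^-1` [set x] else set0.
have mG k : measurable (G k) by rewrite /G; case: pickle_inv => // x; exact: mX.
have GE : \bigcup_k G k = setT.
  apply/seteqP; split=> // t _; exists (choice.pickle (X t)) => //.
  by rewrite /G pickleK_inv.
have tG : trivIset setT G.
  apply/trivIsetP => i j _ _ ij; apply/seteqP; split=> // t.
  rewrite /G; case ei: (pickle_inv i) => [x|]; case ej: (pickle_inv j) => [y|];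
    rewrite ?set0I ?setI0// => -[/= xt yt].
  have := @pickle_invK E i; have := @pickle_invK E j; rewrite /ocancel ei ej /=.
  by move=> jy ix; move/eqP : ij; rewrite -jy -ix -xt -yt.
pose c (k : nat) : \bar R := if pickle_inv k is Some x then law P X x * (f x)%:E else 0.
have law0 x : 0 <= law P X x * (f x)%:E by rewrite mule_ge0 ?lee_fin.
have c0 k : 0 <= c k by rewrite /c; case: pickle_inv.
transitivity (\esum_(k in [set: nat]) c k).
  rewrite -GE ge0_integral_bigcup//; first last.
  - by move=> t _; rewrite lee_fin.
  - rewrite GE; exact: (discrete_rv_measurable_fun (EFin \o f) mX).
  rewrite -nneseries_esumT//; apply: eq_eseriesr => k _.
  rewrite /G /c; case: pickle_inv => [x|]; last by rewrite integral_set0.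
  transitivity (\int[P]_(t in X @^-1` [set x]) (cst (f x)%:E t)).
    by apply: eq_integral => t; rewrite inE /= => ->.
  by rewrite integral_cst 1?muleC//; exact: mX.
have pinj : set_inj [set: E] (@choice.pickle E).
  by move=> x y _ _; exact: (pcan_inj (@choice.pickleK E)).
transitivity (\esum_(k in @choice.pickle E @` setT) c k).
  rewrite [RHS]esum_mkcond; apply: eq_esum => k _.
  case: ifPn => // kE; rewrite /c; case ek: (pickle_inv k) => [x|//].
  exfalso; move/negP: kE; apply; apply/mem_set; exists x => //.
  by have := @pickle_invK E k; rewrite /ocancel ek.
rewrite esum_image//; apply: eq_esum => x _.
by rewrite /c pickleK_inv.
Qed.

Lemma esum_fin {J : finType} (f : J -> \bar R) : (forall j, 0 <= f j) ->
  \esum_(j in [set: J]) f j = \sum_j f j.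
Proof.
move=> f0; rewrite esum_fset//; last exact: finite_finset.
rewrite fsbig_finite; last exact: finite_finset.
rewrite [RHS](perm_big (fset_set [set: J])) //=.
apply: uniq_perm; rewrite ?fset_uniq ?index_enum_uniq// => j.
by rewrite mem_index_enum in_fset_set ?in_setT//; exact: finite_finset.
Qed.

End discrete_random_variables.

Section driven_chain.
Context {R : realType} {S : countType} {W : finType}.
Context (w : W -> R) (F : S -> W -> S).
Context {disp : measure_display} {T : measurableType disp} (P : probability T R).
Context (X : nat -> T -> S) (Z : nat -> T -> W).

(** [history X t.+1] rather than [X t] in the independence clause, because the
    Markov property conditions on the whole past. *)
Record driven_chain : Prop := DrivenChain {
  driven_start_rv : discrete_rv (X 0);
  driven_noise_rv : forall t, discrete_rv (Z t);
  driven_step : forall t om, X t.+1 om = F (X t om) (Z t om);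
  driven_indep : forall t z (B : set (seq S)),
    (P (Z t @^-1` [set z] `&` history X t.+1 @^-1` B) =
     (w z)%:E * P (history X t.+1 @^-1` B))%E }.

Context (K : S -> S -> \bar R).
Hypothesis KE : forall x y, K x y = (transfer w F (point_mass y) x)%:E.
Context (d : S -> S -> R) (o : S) (N : S -> nat) (g C k : R).
Hypothesis H : contractive_iteration w F d o N g C k.
Hypothesis HX : driven_chain.

Lemma driven_rv t : discrete_rv (X t).
Proof.
elim: t => [|t IH]; first exact: (driven_start_rv HX).
rewrite (_ : X t.+1 = (fun p => F p.1 p.2) \o (fun om => (X t om, Z t om))).
  by apply/discrete_rv_comp/discrete_rv_pair => //; exact: (driven_noise_rv HX).
by apply/funext => om /=; exact: (driven_step HX).
Qed.

Lemma driven_indep_state t z (B : set S) :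
  (P (Z t @^-1` [set z] `&` X t @^-1` B) = (w z)%:E * P (X t @^-1` B))%E.
Proof.
have -> : X t @^-1` B = history X t.+1 @^-1` [set h | exists2 x, B x & last x h = x].
  apply/seteqP; split=> om; rewrite /preimage /mkset historyS.
    by move=> BX; exists (X t om) => //; rewrite last_rcons.
  by case=> x Bx; rewrite last_rcons => ->.
exact: (driven_indep HX).
Qed.

Lemma driven_integral t (f : S -> R) : (forall x, 0 <= f x) ->
  (\int[P]_om (f (X t.+1 om))%:E = \int[P]_om (transfer w F f (X t om))%:E)%E.
Proof.
move=> f0.
have tf0 x : 0 <= transfer w F f x by exact: (transfer_ge0 H).
have mXZ : discrete_rv (fun om => (X t om, Z t om)).
  by apply: discrete_rv_pair; [exact: driven_rv|exact: (driven_noise_rv HX)].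
transitivity (\int[P]_om (f (F (X t om, Z t om).1 (X t om, Z t om).2))%:E)%E.
  by apply: eq_integral => om _; rewrite (driven_step HX).
rewrite (integral_discrete_rv P (f := fun p => f (F p.1 p.2)) mXZ)//.
rewrite (integral_discrete_rv P (driven_rv t))//.
transitivity (\esum_(x in [set: S]) \esum_(z in [set: W])
    (law P (X t) x * (w z * f (F x z))%:E)%E).
  rewrite esum_esum; last first.
    by move=> x z _ _; rewrite mule_ge0// lee_fin mulr_ge0 ?(noise_ge0 H).
  have -> : [set: S * W] = [set: S] `*`` (fun=> [set: W]) by apply/seteqP; split.
  apply: eq_esum => -[x z] _ /=; rewrite /law.
  rewrite (_ : _ @^-1` _ = Z t @^-1` [set z] `&` X t @^-1` [set x]); last first.
    by apply/seteqP; split=> om /= [-> ->].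
  by rewrite driven_indep_state EFinM muleA (muleC (w z)%:E).
apply: eq_esum => x _; rewrite esum_fin; last first.
  by move=> z; rewrite mule_ge0// lee_fin mulr_ge0 ?(noise_ge0 H).
rewrite -ge0_sume_distrr ?sumEFin// => z _.
by rewrite lee_fin mulr_ge0 ?(noise_ge0 H).
Qed.

Lemma driven_integral_iter t (f : S -> R) : (forall x, 0 <= f x) ->
  (\int[P]_om (f (X t om))%:E =
   \int[P]_om (iter_transfer w F t f (X 0%N om))%:E)%E.
Proof.
elim: t f => // t IH f f0; rewrite driven_integral// IH; last first.
  by move=> x; exact: (transfer_ge0 H).
by apply: eq_integral => om _; rewrite /iter_transfer iterSr.
Qed.

Lemma driven_prob t (A : set S) :
  (P (X t @^-1` A) = \int[P]_om (\1_A (X t om))%:E)%E.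
Proof.
rewrite -[LHS]mul1e -[LHS]integral_cst; last exact/discrete_rv_preimage/driven_rv.
rewrite integral_mkcond; apply: eq_integral => om _.
rewrite patchE indicE /= (_ : (om \in X t @^-1` A) = (X t om \in A)).
  by case: (_ \in _).
by apply/idP/idP => /set_mem ?; exact: mem_set.
Qed.

(** The probability of [y] at time [t] is the mean of U^t 1_y over the initial
    law, and these functions are bounded by 1 and converge to a constant. *)
Lemma driven_law_cvg y : (law P (X t) y @[t --> \oo] --> limit_law w F o y)%E.
Proof.
have pm0 x : 0 <= point_mass y x :> R by exact: ler0n.
have pm1 x : point_mass y x <= 1 :> R by rewrite /point_mass; case: eqP; rewrite ?lexx.
have pmE x : \1_[set y] x = point_mass y x :> R.
  rewrite indicE /point_mass; congr ((nat_of_bool _)%:R).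
  by apply/idP/eqP => [/set_mem//|->]; exact: mem_set.
rewrite (_ : (fun t => _) = (fun t =>
    \int[P]_om (iter_transfer w F t (point_mass y) (X 0%N om))%:E)%E); last first.
  apply/funext => t; rewrite /law driven_prob -driven_integral_iter//.
  by apply: eq_integral => om _; rewrite pmE.
rewrite (_ : limit_law w F o y = \int[P]_om limit_law w F o y)%E; last first.
  rewrite -[LHS]mule1 -(probability_setT P) -integral_cst//.
have cvgX om : (iter_transfer w F t (point_mass y) (X 0%N om))%:E @[t --> \oo] -->
    limit_law w F o y.
  apply: cvg_EFin; first exact: nearW.
  exact: (cvg_iter_transfer H _ (dist_lipschitz_point_mass H y)).
apply: (@dominated_cvg _ _ _ _ _ measurableT _ _ (cst 1%E)) => //.
- move=> t; apply: (discrete_rv_measurable_fun (fun x => (iter_transfer w F t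
    (point_mass y) x)%:E) (driven_start_rv HX)).
- exact: finite_measure_integrable_cst.
- move=> t om _; rewrite gee0_abs ?lee_fin; last exact: (iter_transfer_ge0 H).
  by rewrite -(iter_transfer_cst H t 1 (X 0 om)); exact: (iter_transfer_le H).
Qed.

Lemma driven_steady_state : steady_state_law K P X (limit_law w F o).
Proof.
split.
- exact: (limit_law_ge0 H).
- exact: (limit_law_sum1 H).
- move=> y; rewrite -(limit_law_transfer H y).
  by apply: eq_esum => x _; rewrite KE.
- exact: driven_law_cvg.
Qed.

Lemma driven_markov (t : nat) (x : nat -> S) (y : S) :
  (P ([set om | forall j, (j <= t)%N -> X j om = x j] `&` X t.+1 @^-1` [set y]) =
   P [set om | forall j, (j <= t)%N -> X j om = x j] * K (x t) y)%E.
Proof.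
set A := [set om | _].
have AE : A = history X t.+1 @^-1` [set [seq x j | j <- iota 0 t.+1]].
  apply/seteqP; split=> om /=.
    move=> Aom; apply/eq_in_map => j; rewrite mem_iota add0n ltnS => /andP[_].
    exact: Aom.
  move=> /eq_in_map e j jt; apply: e.
  by rewrite mem_iota add0n ltnS.
have mA : measurable A.
  by rewrite AE; apply: discrete_rv_history => j; exact: driven_rv.
have -> : A `&` X t.+1 @^-1` [set y] =
    \bigcup_(z in [set z | F (x t) z = y]) (Z t @^-1` [set z] `&` A).
  apply/seteqP; split=> [om [Aom /= <-]|om [z /= Fy [/= zom Aom]]].
    exists (Z t om) => //=.
    by rewrite (driven_step HX) (Aom t (leqnn t)).
  by split=> //=; rewrite (driven_step HX) (Aom t (leqnn t)) zom.
rewrite measure_fin_bigcup//; first last.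
- by move=> z _; apply: measurableI => //; exact: (driven_noise_rv HX).
- by apply/trivIsetP => i j _ _ /eqP ij; apply/seteqP; split=> // om [[/= -> _] [/= /ij]].
- exact: finite_finset.
rewrite KE fsbig_mkcond/= fsbig_finite; last exact: finite_finset.
transitivity (\sum_z P A * (w z * point_mass y (F (x t) z))%:E)%E; last first.
  rewrite -ge0_sume_distrr ?sumEFin// => z _.
  by rewrite lee_fin mulr_ge0 ?(noise_ge0 H)//; exact: ler0n.
rewrite (perm_big (index_enum W)) /=; last first.
  apply: uniq_perm; rewrite ?fset_uniq ?index_enum_uniq// => j.
  by rewrite mem_index_enum in_fset_set ?in_setT//; exact: finite_finset.
apply: eq_bigr => z _; rewrite patchE /point_mass; case: ifPn => [/set_mem /= ->|].
  by rewrite eqxx mulr1 AE (driven_indep HX) muleC.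
move=> zy; case: eqP => [e|_]; last by rewrite mulr0 mule0.
by exfalso; move/negP: zy; apply; apply/mem_set.
Qed.

(** The reachable set is closed, so its indicator lies below its image by the
    transfer operator. *)
Lemma driven_state_space t :
  P (X 0%N @^-1` [set y | reachable K o y]) = 1%E ->
  P (X t @^-1` [set y | reachable K o y]) = 1%E.
Proof.
set D := [set y | _] => X0D; elim: t => // t IH.
have mD s : measurable (X s @^-1` D) by exact/discrete_rv_preimage/driven_rv.
apply/eqP; rewrite eq_le probability_le1//= -IH !driven_prob.
rewrite [leRHS]driven_integral; last by move=> x; exact: ler0n.
apply: ge0_le_integral => //.
- exact: (discrete_rv_measurable_fun (fun x => (\1_D x)%:E) (driven_rv t)).
- exact: (discrete_rv_measurable_fun (fun x => (transfer w F (\1_D) x)%:E) (driven_rv t)).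
move=> om _; rewrite lee_fin indicE; case: (boolP (_ \in D)) => [/set_mem Dx|_]; last first.
  by apply: (transfer_ge0 H) => x; exact: ler0n.
have := kernel_sum_reachable H KE Dx.
have := @esum_kernel _ _ _ _ _ _ _ _ _ _ _ H _ KE D (X t om) (fun=> 1) (fun=> ler01).
under eq_esum do rewrite mule1.
move=> -> [<-]; apply: (transfer_le H) => z.
by rewrite mulr1.
Qed.

Lemma driven_is_markov_chain :
  P (X 0%N @^-1` [set y | reachable K o y]) = 1%E ->
  is_markov_chain K P [set y | reachable K o y] X.
Proof.
move=> X0D; split.
- by move=> x y _; rewrite KE lee_fin; apply: (transfer_ge0 H) => z; exact: ler0n.
- by move=> x; exact: (kernel_sum_reachable H KE).
- exact: driven_rv.
- by move=> t; exact: driven_state_space.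
- exact: driven_markov.
Qed.

End driven_chain.

(** * The geometry of one switch step *)

Section exponential_scale.
Context {R : realType} (z : R).
Hypothesis z_gt1 : 1 < z.

Lemma exp_ge_linear x : x%:R * (z - 1) <= z ^+ x - 1.
Proof.
elim: x => [|x IH]; first by rewrite mul0r expr0 subrr.
have zx : 1 <= z ^+ x by rewrite exprn_ege1// ltW.
have : 0 <= (z - 1) * (z ^+ x - 1) by rewrite mulr_ge0 ?subr_ge0// ltW.
by rewrite -natr1 exprS; lra.
Qed.

Lemma exp_lipschitz (f : nat -> R) L :
  (forall x, `|f x.+1 - f x| <= L * (z ^+ x.+1 - z ^+ x)) ->
  forall x y, `|f x - f y| <= L * `|z ^+ x - z ^+ y|.
Proof.
move=> fL x y; wlog yx : x y / (y <= x)%N.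
  move=> h; have [/h//|/ltnW/h] := leqP y x.
  by rewrite distrC (distrC (z ^+ y)).
have zz : z ^+ y <= z ^+ x by rewrite ler_eXn2l.
rewrite [X in L * X]ger0_norm ?subr_ge0// {zz}.
elim: x yx => [|x IH]; first by rewrite leqn0 => /eqP ->; rewrite !subrr normr0 mulr0.
rewrite leq_eqVlt => /orP[/eqP ->|/IH {}IH].
  by rewrite !subrr normr0 mulr0.
rewrite (_ : f x.+1 - f y = (f x.+1 - f x) + (f x - f y)); last by rewrite addrA subrK.
apply: le_trans (ler_normD _ _) _; apply: le_trans (lerD (fL x) IH) _.
by rewrite -mulrDr addrA subrK.
Qed.

Lemma exp_lipschitz_id x y : `|x%:R - y%:R| <= (z - 1)^-1 * `|z ^+ x - z ^+ y|.
Proof.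
have h0 : 0 < z - 1 by rewrite subr_gt0.
apply: (exp_lipschitz (f := fun x => x%:R)) => {y} {}x.
rewrite -natr1 addrAC subrr add0r normr1 ler_pdivlMl// mulr1 exprS.
have zx : 1 <= z ^+ x by rewrite exprn_ege1// ltW.
by nra.
Qed.

(** Chosen so that 2 (x + 1) <= quad_const (z - 1) z^x: x (z - 1) and 1 are both
    at most z^x. *)
Definition quad_const : R := 2 * ((z - 1)^-1 + 1) / (z - 1).

Lemma exp_lipschitz_quad x y :
  `|x%:R * (x%:R + 1) - y%:R * (y%:R + 1)| <= quad_const * `|z ^+ x - z ^+ y|.
Proof.
have h0 : 0 < z - 1 by rewrite subr_gt0.
apply: (exp_lipschitz (f := fun x => x%:R * (x%:R + 1))) => {y} {}x.
rewrite -natr1 (_ : _ - _ = 2 * (x%:R + 1)); last by ring.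
rewrite ger0_norm; last by rewrite mulr_ge0// addr_ge0.
rewrite (_ : z ^+ x.+1 - z ^+ x = (z - 1) * z ^+ x); last by rewrite exprS; ring.
rewrite /quad_const mulrA divfK ?gt_eqF// -mulrA ler_wpM2l// mulrDl mul1r lerD//.
  by rewrite mulrC ler_pdivlMr// (le_trans (exp_ge_linear x))// gerBl.
by rewrite exprn_ege1// ltW.
Qed.

(** In the coordinate z^x one step is u |-> max(1, z^(a-s) u). Both sides are
    multiplied by z to keep the exponent a + 1 - s a natural number. The
    inequality can be strict only when the smaller queue is empty and is offered
    a service that it cannot use. *)
Lemma exp_step_contract (x y a s : nat) : (s <= 1)%N ->
  z * `|z ^+ (x + a - s) - z ^+ (y + a - s)| <= z ^+ (a + 1 - s) * `|z ^+ x - z ^+ y|.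
Proof.
move=> s1; wlog yx : x y / (y <= x)%N.
  move=> h; have [/h//|/ltnW/h] := leqP y x.
  by rewrite distrC (distrC (z ^+ y)).
have z0 : 0 <= z by rewrite (le_trans ler01)// ltW.
have zz m p : (m <= p)%N -> z ^+ m <= z ^+ p by move=> mp; rewrite ler_eXn2l.
rewrite ger0_norm ?subr_ge0 ?zz ?leq_sub2r ?leq_add2r// ger0_norm ?subr_ge0 ?zz//.
rewrite !mulrBr -!exprS -!exprD.
have [ys|ys] := leqP s (y + a).
  rewrite le_eqVlt; apply/orP; left; apply/eqP.
  by congr (_ ^+ _ - _ ^+ _); lia.
have -> : s = 1%N by lia.
have -> : a = 0%N by lia.
have -> : y = 0%N by lia.
case: x yx => [|x] _; first by rewrite !subrr.
rewrite (_ : (x.+1 + 0 - 1).+1 = (0 + 1 - 1 + x.+1)%N); last by lia.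
by rewrite lerD2l lerN2 zz.
Qed.

Lemma exp_le_linear c A : (c <= A)%N -> z ^+ c <= 1 + (z - 1) * (c%:R * z ^+ A).
Proof.
have h0 : 0 < z - 1 by rewrite subr_gt0.
elim: c => [|c IH] cA; first by rewrite expr0 mul0r mulr0 addr0.
have := IH (ltnW cA).
have : z ^+ c <= z ^+ A by rewrite ler_eXn2l// ltnW.
rewrite exprS -natr1; move: (z ^+ A) (z ^+ c) (c%:R : R) => u v t; nra.
Qed.

End exponential_scale.

(** Take z = 1 + e with e = delta / A: by the Bernoulli inequality
    1 - delta <= (1 - e)^A, and (1 - e)(1 + e) < 1. *)
Lemma exists_exp_scale {R : realType} (delta : R) (A : nat) :
  0 < delta <= 1 -> (0 < A)%N ->
  exists2 z : R, 1 < z & (1 - delta) * z ^+ A < 1.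
Proof.
move=> /andP[d0 d1] A0; pose e := delta / A%:R.
have AR : 0 < A%:R :> R by rewrite ltr0n.
have e0 : 0 < e by rewrite divr_gt0.
have e1 : e <= 1.
  by rewrite ler_pdivrMr// mul1r (le_trans d1)// ler1n.
have bern m : 1 - m%:R * e <= (1 - e) ^+ m.
  elim: m => [|m IH]; first by rewrite mul0r subr0 expr0.
  have m0 : 0 <= m%:R :> R by [].
  rewrite exprS -natr1.
  have : (1 - e) * (1 - m%:R * e) <= (1 - e) * (1 - e) ^+ m.
    by rewrite ler_wpM2l// subr_ge0.
  nra.
exists (1 + e); first by rewrite ltrDl.
have -> : delta = A%:R * e by rewrite /e mulrC divfK// gt_eqF.
apply: (@le_lt_trans _ _ ((1 - e) ^+ A * (1 + e) ^+ A)).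
  by rewrite ler_wpM2r// exprn_ge0// addr_ge0// ltW.
rewrite -exprMn (_ : (1 - e) * (1 + e) = 1 - e ^+ 2); last by ring.
rewrite exprn_ilt1 -?lt0n//.
  by rewrite subr_ge0 expr_le1// ltW.
by rewrite gtrBl exprn_gt0.
Qed.

(** With c = a + 1 - s the left side is (x + c) (x + c - 1): the truncation is
    invisible because it occurs only when x + c = 0, where both sides vanish. *)
Lemma quad_step {R : comRingType} (x a s : nat) : (s <= 1)%N ->
  (x + a - s)%N%:R * ((x + a - s)%N%:R + 1) = x%:R * (x%:R + 1) +
    ((a + 1 - s)%N%:R ^+ 2 - (a + 1 - s)%N%:R
     - 2 * x%:R * (1 - (a + 1 - s)%N%:R)) :> R.
Proof.
case: s => [|[|//]] _; first by rewrite !subn0 !natrD; ring.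
rewrite addnK; case e : (x + a)%N => [|m].
  have -> : x = 0%N by lia.
  have -> : a = 0%N by lia.
  by rewrite sub0n; ring.
have xam : x%:R + a%:R = m%:R + 1 :> R by rewrite -natrD e natr1.
rewrite subn1 /= (_ : m%:R = x%:R + a%:R - 1); last by rewrite xam addrK.
by ring.
Qed.

Section switch_map.
Context {n amax : nat}.

(** Arrivals are bounded, so the noise of a slot lives in a finite type and the
    transfer operator is a finite sum. *)
Definition switch_noise : finType := ('M['I_amax.+1]_n * 'S_n)%type.

Definition noise_arrivals (om : switch_noise) : 'M[nat]_n :=
  map_mx (@nat_of_ord amax.+1) om.1.

Definition noise_schedule (om : switch_noise) : 'M[nat]_n := perm_mx om.2.

Definition switch_map (x : 'M[nat]_n) (om : switch_noise) : 'M[nat]_n :=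
  next_queue x (noise_arrivals om) (noise_schedule om).

Lemma switch_mapE x om i j : switch_map x om i j =
  (x i j + noise_arrivals om i j - noise_schedule om i j)%N.
Proof. by rewrite mxE. Qed.

Lemma noise_scheduleE om i j : noise_schedule om i j = (om.2 i == j) :> nat.
Proof. by rewrite !mxE; case: eqP. Qed.

Lemma noise_schedule_le1 om i j : (noise_schedule om i j <= 1)%N.
Proof. by rewrite noise_scheduleE leq_b1. Qed.

Lemma noise_arrivals_le om i j : (noise_arrivals om i j <= amax)%N.
Proof. by rewrite mxE -ltnS. Qed.

Lemma queue_total_finite L : finite_set [set x : 'M[nat]_n | (queue_total x <= L)%N].
Proof.
apply: (@sub_finite_set _ _ (map_mx (@nat_of_ord L.+1) @` [set: 'M['I_L.+1]_n])); last first.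
  exact/finite_image/finite_finset.
move=> x /= xL; exists (map_mx inord x) => //.
apply/matrixP => i j; rewrite !mxE inordK// ltnS (leq_trans _ xL)//.
by rewrite /queue_total (bigD1 i)//= (bigD1 j)//= -addnA leq_addr.
Qed.

Lemma queue_total_eq0 (x : 'M[nat]_n) : queue_total x = 0%N -> x = 0.
Proof.
move=> /eqP; rewrite sum_nat_eq0 => /forallP h; apply/matrixP => i j.
by have := h i; rewrite /= sum_nat_eq0 => /forallP/(_ j)/eqP ->; rewrite mxE.
Qed.

(** Without arrivals, a permutation that serves a nonempty queue. *)
Lemma switch_map_drain (x : 'M[nat]_n) : exists p : 'S_n,
  (queue_total (switch_map x (const_mx ord0, p)) <= (queue_total x).-1)%N.
Proof.
have le0 p i j : (switch_map x (const_mx ord0, p) i j <= x i j)%N.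
  by rewrite !mxE addn0 leq_subr.
have [x0|] := eqVneq (queue_total x) 0%N.
  exists 1%g; rewrite x0 leqn0 sum_nat_eq0; apply/forallP => i /=.
  rewrite sum_nat_eq0; apply/forallP => j /=; rewrite -leqn0.
  by rewrite (leq_trans (le0 _ _ _))// (queue_total_eq0 x0) mxE.
rewrite sum_nat_eq0 negb_forall => /existsP[i] /=.
rewrite sum_nat_eq0 negb_forall => /existsP[j] /= xij.
exists (tperm i j).
have lt0 : (switch_map x (const_mx ord0, tperm i j) i j < x i j)%N.
  rewrite !mxE addn0 tpermL eqxx; move: xij; rewrite -lt0n /=.
  by case: (x i j) => // m _; rewrite subn1.
suff : (queue_total (switch_map x (const_mx ord0, tperm i j)) < queue_total x)%N.
  by move=> h; rewrite -ltnS prednK// (leq_ltn_trans _ h).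
rewrite /queue_total [X in (X < _)%N](bigD1 i)//= [ltnRHS](bigD1 i)//= -addSn.
apply: leq_add; last by apply: leq_sum => i' _; apply: leq_sum => j' _; exact: le0.
rewrite (bigD1 j)//= [leqRHS](bigD1 j)//= -addSn.
by apply: leq_add => //; apply: leq_sum => j' _; exact: le0.
Qed.

Context {R : realType} (z : R).
Hypothesis z_gt1 : 1 < z.

(** The factor 1 / (z - 1) makes distinct states at distance at least 1. *)
Definition queue_dist (x y : 'M[nat]_n) : R :=
  \sum_i \sum_j (z - 1)^-1 * `|z ^+ x i j - z ^+ y i j|.

(** The quadratic function whose mean drift is affine in the total queue. *)
Definition queue_quad (x : 'M[nat]_n) : R :=
  \sum_i \sum_j (x i j)%:R * ((x i j)%:R + 1).

Lemma queue_totalE (x : 'M[nat]_n) :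
  (queue_total x)%:R = \sum_i \sum_j (x i j)%:R :> R.
Proof. by rewrite natr_sum; apply: eq_bigr => i _; rewrite natr_sum. Qed.

Lemma zV_ge0 : 0 <= (z - 1)^-1.
Proof. by rewrite invr_ge0 subr_ge0 ltW. Qed.

Lemma queue_dist_ge0 x y : 0 <= queue_dist x y.
Proof. by apply: sumr_ge0 => i _; apply: sumr_ge0 => j _; rewrite mulr_ge0 ?zV_ge0. Qed.

Lemma queue_dist_sym x y : queue_dist x y = queue_dist y x.
Proof. by apply: eq_bigr => i _; apply: eq_bigr => j _; rewrite distrC. Qed.

Lemma queue_dist_triangle x y u :
  queue_dist x u <= queue_dist x y + queue_dist y u.
Proof.
rewrite -big_split; apply: ler_sum => i _; rewrite -big_split /=.
apply: ler_sum => j _; rewrite -mulrDr ler_wpM2l ?zV_ge0//.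
by rewrite (le_trans _ (ler_normD _ _))// addrA subrK.
Qed.

Lemma queue_sum_lipschitz (f : nat -> R) L :
  0 <= L -> (forall x y, `|f x - f y| <= L * ((z - 1)^-1 * `|z ^+ x - z ^+ y|)) ->
  dist_lipschitz queue_dist L (fun x : 'M[nat]_n => \sum_i \sum_j f (x i j)).
Proof.
move=> L0 fL; split=> // x y.
rewrite -sumrB (le_trans (ler_norm_sum _ _ _))// big_distrr/=.
apply: ler_sum => i _; rewrite -sumrB (le_trans (ler_norm_sum _ _ _))// big_distrr/=.
by apply: ler_sum => j _; exact: fL.
Qed.

Lemma queue_total_lipschitz :
  dist_lipschitz queue_dist 1 (fun x : 'M[nat]_n => (queue_total x)%:R).
Proof.
rewrite (_ : (fun x => _) = (fun x : 'M[nat]_n => \sum_i \sum_j (x i j)%:R)).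
  apply: (@queue_sum_lipschitz (fun x => x%:R)) => // x y.
  by rewrite mul1r exp_lipschitz_id.
by apply/funext => x; exact: queue_totalE.
Qed.

Lemma quad_const_ge0 : 0 <= quad_const z.
Proof.
rewrite /quad_const !mulr_ge0 ?zV_ge0// addr_ge0 ?zV_ge0//.
Qed.

Lemma queue_quad_lipschitz :
  dist_lipschitz queue_dist (quad_const z * (z - 1)) queue_quad.
Proof.
apply: (@queue_sum_lipschitz (fun x => x%:R * (x%:R + 1))).
  by rewrite mulr_ge0 ?quad_const_ge0// subr_ge0 ltW.
move=> x y; rewrite -mulrA mulVKf ?exp_lipschitz_quad//.
by rewrite subr_eq0 gt_eqF.
Qed.

Lemma queue_dist_ge1 x y : x != y -> 1 <= queue_dist x y.
Proof.
move=> /eqP xy.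
have [[i j] /= xyij] : exists ij : 'I_n * 'I_n, x ij.1 ij.2 != y ij.1 ij.2.
  apply/existsP; apply: contra_notT xy => /existsPn h.
  by apply/matrixP => i j; apply/eqP; have := h (i, j); rewrite negbK.
rewrite /queue_dist (bigD1 i)//= (bigD1 j)//= -addrA.
rewrite (le_trans (_ : 1 <= (z - 1)^-1 * `|z ^+ x i j - z ^+ y i j|))//.
  apply: le_trans (exp_lipschitz_id z_gt1 _ _).
  wlog : x y xyij {xy} / (y i j < x i j)%N.
    move=> h; have := xyij; rewrite neq_ltn => /orP[l|]; last exact: h.
    by rewrite distrC; apply: h l; rewrite eq_sym.
  move=> l; rewrite -natrB ?(ltnW l)// ger0_norm// ler1n.
  by rewrite subn_gt0.
rewrite lerDl addr_ge0//.
  by apply: sumr_ge0 => k _; rewrite mulr_ge0 ?zV_ge0.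
by apply: sumr_ge0 => k _; apply: sumr_ge0 => l _; rewrite mulr_ge0 ?zV_ge0.
Qed.

(** Cauchy-Schwarz against the constant 1, from the sum of all
    (f i - f j)^2. *)
Lemma sqr_sum_le (I : finType) (f : I -> R) :
  (\sum_i f i) ^+ 2 <= #|I|%:R * \sum_i f i ^+ 2.
Proof.
have h : 0 <= \sum_i \sum_j (f i - f j) ^+ 2.
  by apply: sumr_ge0 => i _; apply: sumr_ge0 => j _; exact: sqr_ge0.
have e : \sum_i \sum_j (f i - f j) ^+ 2 =
    2 * (#|I|%:R * \sum_i f i ^+ 2) - 2 * (\sum_i f i) ^+ 2.
  have e1 i : \sum_j (f i - f j) ^+ 2 =
      #|I|%:R * f i ^+ 2 + \sum_j f j ^+ 2 - 2 * f i * \sum_j f j.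
    rewrite mulr_natl -sumr_const big_distrr -big_split -sumrB /=.
    by apply: eq_bigr => j _; ring.
  under eq_bigr do rewrite e1.
  rewrite sumrB big_split /= -!big_distrr /= sumr_const -mulr_natl.
  rewrite -!big_distrl -big_distrr /=; ring.
rewrite e in h; lra.
Qed.

Lemma queue_total_sqr_le (x : 'M[nat]_n) :
  (queue_total x)%:R ^+ 2 <=
  n%:R ^+ 2 * (quad_const z * (z - 1)) * (1 + queue_dist x 0).
Proof.
apply: (@le_trans _ _ (n%:R ^+ 2 * queue_quad x)); last first.
  rewrite -mulrA ler_wpM2l ?exprn_ge0//.
  have [c0 /(_ x 0)] := queue_quad_lipschitz.
  have -> : queue_quad 0 = 0.
    by rewrite /queue_quad big1// => i _; rewrite big1// => j _; rewrite mxE mul0r.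
  rewrite subr0 => h; apply: le_trans (ler_norm _) _; apply: le_trans h _.
  by rewrite ler_wpM2l// lerDr.
rewrite queue_totalE pair_big /=.
apply: le_trans (sqr_sum_le _) _; rewrite card_prod card_ord natrM -expr2.
rewrite ler_wpM2l ?exprn_ge0// /queue_quad pair_big /=.
by apply: ler_sum => ij _; rewrite mulrDr mulr1 -expr2 lerDl.
Qed.

Lemma switch_map_contract x y om :
  queue_dist (switch_map x om) (switch_map y om) <=
  \sum_i \sum_j z ^+ (noise_arrivals om i j + 1 - noise_schedule om i j) / z *
    ((z - 1)^-1 * `|z ^+ x i j - z ^+ y i j|).
Proof.
have z0 : 0 < z by rewrite (lt_trans _ z_gt1).
apply: ler_sum => i _; apply: ler_sum => j _.
rewrite mulrCA ler_wpM2l ?zV_ge0// mulrAC ler_pdivlMr// mulrC.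
rewrite !switch_mapE.
exact: exp_step_contract (noise_schedule_le1 _ _ _).
Qed.

Lemma switch_map_quad x om : queue_quad (switch_map x om) =
  queue_quad x + \sum_i \sum_j
    ((noise_arrivals om i j + 1 - noise_schedule om i j)%N%:R ^+ 2
     - (noise_arrivals om i j + 1 - noise_schedule om i j)%N%:R
     - 2 * (x i j)%:R *
       (1 - (noise_arrivals om i j + 1 - noise_schedule om i j)%N%:R)).
Proof.
rewrite /queue_quad -big_split; apply: eq_bigr => i _; rewrite -big_split.
apply: eq_bigr => j _ /=.
by rewrite switch_mapE quad_step ?noise_schedule_le1.
Qed.

End switch_map.

(** * The noise of a switch under random scheduling *)

(** The number of permutations sending i to k does not depend on k, as composing
    with a transposition shows, and these numbers add up to n!. *)
Lemma perm_uniform_entry {R : numFieldType} {n : nat} (i j : 'I_n) :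
  \sum_(p : 'S_n) ((p i == j)%:R : R) / n`!%:R = n%:R^-1.
Proof.
pose N k : R := \sum_(p : 'S_n) (p i == k)%:R.
have Nj k : N k = N j.
  rewrite /N (reindex_inj (mulIg (tperm k j))) /=; apply: eq_bigr => p _.
  by rewrite permM -[in LHS](can_eq (tpermK k j)) tpermK tpermL.
have sumN : \sum_k N k = n`!%:R.
  rewrite exchange_big /= -card_Sn -sum1_card natr_sum.
  apply: eq_bigr => p _; rewrite (bigD1 (p i))//= eqxx big1 ?addr0// => k.
  by rewrite eq_sym => /negbTE ->.
have n0 : n%:R != 0 :> R by rewrite pnatr_eq0 -lt0n (leq_ltn_trans _ (ltn_ord i)).
have f0 : n`!%:R != 0 :> R by rewrite pnatr_eq0 -lt0n fact_gt0.
rewrite -mulr_suml -/(N j); apply: (mulfI n0); rewrite divff// mulrA.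
suff -> : n%:R * N j = n`!%:R by rewrite divff.
rewrite -sumN (eq_bigr (fun=> N j)); last by move=> k _.
by rewrite sumr_const card_ord mulr_natl.
Qed.

Lemma perm_mx_nat_inj n : injective (fun p : 'S_n => perm_mx p : 'M[nat]_n).
Proof.
move=> p p' /matrixP pp; apply/permP => i.
have := pp i (p i); rewrite !mxE eqxx.
by case: eqP => // ->.
Qed.

Section switch_noise_law.
Context {R : realType} {n amax : nat}.
Context {disp : measure_display} {T : measurableType disp} (P : probability T R).
Context (lam : R) (a s q : nat -> T -> 'M[nat]_n).
Hypothesis sys : switch_system P amax (const_mx lam) a s q.

Let arr := switch_arrivals sys.
Let sched := switch_schedules sys.

Definition noise_weight (om : switch_noise (n := n) (amax := amax)) : R :=
  fine (P (a 0%N @^-1` [set noise_arrivals om])) / n`!%:R.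

Definition driving_noise (t : nat) (e : T) : switch_noise (n := n) (amax := amax) :=
  (map_mx inord (a t e), odflt 1%g [pick p | s t e == perm_mx p]).

(** Arrivals are at most [amax] and schedules are permutation matrices on the
    whole probability space, so nothing is lost in the encoding by
    [driving_noise]. *)
Lemma driving_arrivals t e : noise_arrivals (driving_noise t e) = a t e.
Proof.
apply/matrixP => i j; rewrite !mxE inordK// ltnS.
exact: (arrival_bounded arr).
Qed.

Lemma driving_schedule t e : noise_schedule (driving_noise t e) = s t e.
Proof.
rewrite /noise_schedule /=; case: pickP => [p /eqP ->//|h].
have := schedule_perm sched t e; rewrite /is_perm_mx => /existsP[p /eqP sp].
by have := h p; rewrite sp eqxx.
Qed.

Lemma driving_preimage t om : driving_noise t @^-1` [set om] =
  a t @^-1` [set noise_arrivals om] `&` s t @^-1` [set noise_schedule om].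
Proof.
apply/seteqP; split=> e /=.
  by move=> <-; rewrite driving_arrivals driving_schedule.
case: om => al p [ae se]; rewrite -driving_arrivals in ae.
rewrite -driving_schedule in se; move: ae se.
rewrite /noise_arrivals /noise_schedule; case: (driving_noise t e) => al' p' /=.
move=> /matrixP al_eq /perm_mx_nat_inj ->; congr pair.
by apply/matrixP => i j; apply/val_inj; have := al_eq i j; rewrite !mxE.
Qed.

Lemma driving_noise_rv t : discrete_rv (driving_noise t).
Proof.
move=> om; rewrite driving_preimage; apply: measurableI.
  exact: (arrival_rv arr).
exact: (schedule_rv sched).
Qed.

(** Independence across queues factors the law of the arrival matrix, and each
    factor is the same in every slot. *)
Lemma arrival_law_time t x : P (a t @^-1` [set x]) = P (a 0%N @^-1` [set x]).
Proof.
pose J : {fset 'I_n * 'I_n} := [fset ij in enum {: 'I_n * 'I_n}]%fset.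
have JT ij : ij \in J by rewrite !inE mem_enum.
have lawE u : P (a u @^-1` [set x]) =
    (\prod_(ij <- J) fine (P (arrival_entry a ij.1 ij.2 u @^-1` [set x ij.1 ij.2])))%:E.
  pose A (ij : 'I_n * 'I_n) : set (seq nat) :=
    [set h | last 0%N h = x ij.1 ij.2].
  have := arrival_indep_pairs arr u.+1 J A.
  have AE ij : history (arrival_entry a ij.1 ij.2) u.+1 @^-1` A ij =
      arrival_entry a ij.1 ij.2 u @^-1` [set x ij.1 ij.2].
    by apply/seteqP; split=> e; rewrite /preimage /mkset historyS /A /mkset last_rcons.
  under eq_bigr do rewrite AE.
  move=> <-; congr (P _); apply/seteqP; split=> e /=.
    by move=> ae ij _; rewrite AE /= /arrival_entry ae.
  move=> h; apply/matrixP => i j.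
  by have := h (i, j) (JT (i, j)); rewrite AE.
rewrite !lawE; congr (_%:E); apply: eq_bigr => ij _.
by rewrite (arrival_same_law arr).
Qed.

(** Two independence statements are chained: a(t) is independent of the queues
    and of the schedules up to s(t) itself, and s(t) is independent of the
    queues. *)
Lemma driving_noise_indep t om (B : set (seq 'M[nat]_n)) :
  (P (driving_noise t @^-1` [set om] `&` history q t.+1 @^-1` B) =
   (noise_weight om)%:E * P (history q t.+1 @^-1` B))%E.
Proof.
have -> : driving_noise t @^-1` [set om] `&` history q t.+1 @^-1` B =
    a t @^-1` [set noise_arrivals om] `&`
    (fun e => (history q t.+1 e, history s t.+1 e)) @^-1`
      [set h | B h.1 /\ last 0 h.2 = noise_schedule om].
  rewrite driving_preimage -setIA; congr (_ `&` _).
  by apply/seteqP; split=> e; rewrite /preimage /mkset (historyS s) /= last_rcons => -[].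
rewrite (switch_arrivals_indep sys) arrival_law_time.
have -> : (fun e => (history q t.+1 e, history s t.+1 e)) @^-1`
      [set h | B h.1 /\ last 0 h.2 = noise_schedule om] =
    s t @^-1` [set noise_schedule om] `&`
    (fun e => (history q t.+1 e, history a t e, history s t e)) @^-1`
      [set h | B h.1.1].
  by apply/seteqP; split=> e; rewrite /preimage /mkset (historyS s) /= last_rcons => -[].
rewrite (schedule_indep_past sched) muleA; congr (_ * _)%E.
rewrite -[X in (_ * X)%E]/(law P (s t) (perm_mx om.2)) (schedule_uniform sched).
rewrite /noise_weight EFinM fineK//.
by apply: fin_num_measure; exact: (arrival_rv arr).
Qed.

Lemma driving_noise_law t om :
  law P (driving_noise t) om = (noise_weight om)%:E.
Proof.
have := driving_noise_indep t om setT.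
by rewrite preimage_setT setIT probability_setT mule1.
Qed.

Lemma integral_noise (f : switch_noise (n := n) (amax := amax) -> R) :
  (forall om, 0 <= f om) ->
  (\int[P]_e (f (driving_noise 0 e))%:E)%E = (\sum_om noise_weight om * f om)%:E.
Proof.
move=> f0; rewrite (integral_discrete_rv P (driving_noise_rv 0))//.
rewrite esum_fin; last by move=> om; rewrite mule_ge0// lee_fin.
by rewrite -sumEFin; apply: eq_bigr => om _; rewrite driving_noise_law.
Qed.

Lemma noise_weight_ge0 om : 0 <= noise_weight om.
Proof. by rewrite divr_ge0// fine_ge0. Qed.

Lemma noise_weight_sum1 : \sum_om noise_weight om = 1.
Proof.
have := integral_noise (f := fun=> 1) (fun=> ler01).
rewrite integral_cst// mul1e [X in X = _](probability_setT P) => -[->].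
by apply: eq_bigr => om _; rewrite mulr1.
Qed.

Lemma switch_kernelE x y : switch_kernel P a s x y =
  (transfer noise_weight switch_map (point_mass y) x)%:E.
Proof.
rewrite /transfer -integral_noise; last by move=> om; exact: ler0n.
have mE : discrete_rv (switch_map x \o driving_noise 0).
  exact/discrete_rv_comp/driving_noise_rv.
rewrite /switch_kernel (_ : [set e | _] = (switch_map x \o driving_noise 0) @^-1` [set y]).
  rewrite -[LHS]mul1e -[LHS]integral_cst; last exact: mE.
  rewrite integral_mkcond; apply: eq_integral => e _.
  rewrite patchE /point_mass /=; case: ifPn => [/set_mem /= ->|].
    by rewrite eqxx.
  move=> h; case: eqP => // he.
  by exfalso; move/negP: h; apply; exact/mem_set.
by apply/seteqP; split=> e; rewrite /preimage /mkset /switch_map /= driving_arrivals driving_schedule.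
Qed.

Lemma switch_driven_chain : driven_chain noise_weight switch_map P q driving_noise.
Proof.
split.
- exact: (switch_init_rv sys).
- exact: driving_noise_rv.
- move=> t e; rewrite (switch_evolution sys) /switch_map.
  by rewrite driving_arrivals driving_schedule.
- exact: driving_noise_indep.
Qed.

Definition noise_mean (f : switch_noise (n := n) (amax := amax) -> R) : R :=
  \sum_om noise_weight om * f om.

Lemma noise_meanD f h : noise_mean (f \+ h) = noise_mean f + noise_mean h.
Proof. by rewrite /noise_mean -big_split; apply: eq_bigr => om _; rewrite mulrDr. Qed.

Lemma noise_meanZ c f : noise_mean (fun om => c * f om) = c * noise_mean f.
Proof. by rewrite /noise_mean big_distrr; apply: eq_bigr => om _; rewrite mulrCA. Qed.

Lemma noise_mean_cst c : noise_mean (fun=> c) = c.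
Proof. by rewrite /noise_mean -mulr_suml noise_weight_sum1 mul1r. Qed.

Lemma noise_mean_arrival i j :
  noise_mean (fun om => (noise_arrivals om i j)%:R) = lam.
Proof.
have := arrival_mean arr 0 i j; rewrite unlock.
rewrite (eq_integral (fun e => ((noise_arrivals (driving_noise 0 e) i j)%:R)%:E)).
  by rewrite (integral_noise (f := fun om => (noise_arrivals om i j)%:R))// mxE => -[].
by move=> e _; rewrite driving_arrivals.
Qed.

Lemma noise_mean_var i j : variance P (arrival_real a i j 0) =
  (noise_mean (fun om => ((noise_arrivals om i j)%:R - lam) ^+ 2))%:E.
Proof.
rewrite /variance unlock (arrival_mean arr) mxE /= unlock.
rewrite -integral_noise; last by move=> om; exact: sqr_ge0.
by apply: eq_integral => e _; rewrite driving_arrivals expr2.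
Qed.

(** The weights are products of a weight of the arrivals and the uniform weight
    of the permutation. *)
Lemma noise_mean_factor (f : 'M['I_amax.+1]_n -> R) i j :
  noise_mean (fun om => f om.1 * (noise_schedule om i j)%:R) =
  noise_mean (fun om => f om.1) / n%:R.
Proof.
pose pA (al : 'M['I_amax.+1]_n) : R :=
  fine (P (a 0%N @^-1` [set map_mx (@nat_of_ord amax.+1) al])).
have fact0 : n`!%:R != 0 :> R by rewrite pnatr_eq0 -lt0n fact_gt0.
have pairE (h : 'M['I_amax.+1]_n -> 'S_n -> R) :
    noise_mean (fun om => h om.1 om.2) =
    \sum_al pA al * \sum_p h al p / n`!%:R.
  rewrite /noise_mean -(pair_bigA _ (fun al p => noise_weight (al, p) * h al p)) /=.
  apply: eq_bigr => al _; rewrite big_distrr; apply: eq_bigr => p _ /=.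
  by rewrite /noise_weight mulrAC -mulrA.
transitivity (noise_mean (fun om => f om.1 * (om.2 i == j)%:R)).
  by apply: eq_bigr => om _; rewrite noise_scheduleE.
rewrite (pairE (fun al p => f al * (p i == j)%:R)) (pairE (fun al _ => f al)).
rewrite mulr_suml; apply: eq_bigr => al _; rewrite -mulrA; congr (_ * _).
under eq_bigr do rewrite -mulrA.
rewrite -big_distrr /= perm_uniform_entry sumr_const; congr (_ * _).
rewrite (_ : #|_| = n`!); last by rewrite -(card_Sn n).
by rewrite -[RHS]mulr_natr divfK.
Qed.

End switch_noise_law.

(** * Steady state of the switch *)

Section random_scheduling_switch.
Context {R : realType} {n amax : nat}.
Context {disp : measure_display} {T : measurableType disp} (P : probability T R).
Context (lam : R) (a s q : nat -> T -> 'M[nat]_n).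
Hypothesis sys : switch_system P amax (const_mx lam) a s q.

Let w := noise_weight (n := n) (amax := amax) P a.
Let E := noise_mean (n := n) (amax := amax) P a.

(** One plus the net change a - s of a queue that does not idle; the shift by one
    keeps it a natural number. *)
Definition shifted_change (om : switch_noise (n := n) (amax := amax)) i j : nat :=
  (noise_arrivals om i j + 1 - noise_schedule om i j)%N.

(** The mean service rate of a queue is 1 / n. *)
Definition slack : R := n%:R^-1 - lam.

Definition mean_excess : R :=
  \sum_i \sum_j E (fun om => (shifted_change om i j)%:R ^+ 2 - (shifted_change om i j)%:R).

Lemma noise_mean_sum (I : finType) (f : I -> switch_noise (n := n) (amax := amax) -> R) :
  E (fun om => \sum_i f i om) = \sum_i E (f i).
Proof.
by rewrite /E /noise_mean exchange_big; apply: eq_bigr => om _; rewrite big_distrr.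
Qed.

Lemma noise_mean_schedule i j :
  E (fun om => (noise_schedule om i j)%:R) = n%:R^-1.
Proof.
have := noise_mean_factor P a (fun _ : 'M['I_amax.+1]_n => 1) i j.
rewrite (noise_mean_cst sys) mul1r => <-.
by apply: eq_bigr => om _; rewrite mul1r.
Qed.

Lemma shifted_changeE om i j : (shifted_change om i j)%:R =
  (noise_arrivals om i j)%:R + 1 - (noise_schedule om i j)%:R :> R.
Proof.
rewrite /shifted_change natrB ?natrD//.
by rewrite (leq_trans (noise_schedule_le1 _ _ _))// leq_addl.
Qed.

Lemma shifted_change_mean i j : E (fun om => (shifted_change om i j)%:R) = 1 - slack.
Proof.
rewrite (_ : (fun om => _) = ((fun om => (noise_arrivals om i j)%:R) \+ (fun=> 1)) \+
    (fun om => -1 * (noise_schedule om i j)%:R)); last first.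
  by apply/funext => om /=; rewrite shifted_changeE mulN1r.
rewrite /E !noise_meanD noise_meanZ -/E noise_mean_schedule.
rewrite /E (noise_mean_cst sys) (noise_mean_arrival sys) /slack; ring.
Qed.

Lemma shifted_change_excess i j :
  E (fun om => (shifted_change om i j)%:R ^+ 2 - (shifted_change om i j)%:R) =
  fine (variance P (arrival_real a i j 0)) + lam ^+ 2 + lam - 2 * (lam / n%:R).
Proof.
pose b om : R := (noise_arrivals (n := n) (amax := amax) om i j)%:R.
pose u om : R := (noise_schedule (n := n) (amax := amax) om i j)%:R.
rewrite (noise_mean_var sys) /=.
rewrite (_ : (fun om => (shifted_change om i j)%:R ^+ 2 - (shifted_change om i j)%:R) =
   ((fun om => (b om - lam) ^+ 2) \+ (fun om => (2 * lam + 1) * b om)) \+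
   ((fun=> - lam ^+ 2) \+ (fun om => -2 * (b om * u om)))); last first.
  apply/funext => om /=; rewrite shifted_changeE -/(b om) -/(u om).
  have : u om ^+ 2 = u om.
    by rewrite /u noise_scheduleE; case: eqP => _; rewrite ?expr1n ?expr0n.
  by move: (b om) (u om) => x y yy; ring: yy.
rewrite /E !noise_meanD !noise_meanZ (noise_mean_cst sys) (noise_mean_arrival sys).
rewrite (noise_mean_factor P a (fun al => (map_mx (@nat_of_ord amax.+1) al i j)%:R) i j).
rewrite (noise_mean_arrival sys); ring.
Qed.

(** The mean drift of the quadratic function: the linear term carries the
    slack, the constant term the second moments of the noise. *)
Lemma queue_quad_transfer x : transfer w switch_map queue_quad x =
  queue_quad x + (-2 * slack) * (queue_total x)%:R + mean_excess.
Proof.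
transitivity (E ((fun=> queue_quad x) \+ (fun om => \sum_i \sum_j
    ((shifted_change om i j)%:R ^+ 2 - (shifted_change om i j)%:R
     + (-2 * (x i j)%:R) * (1 - (shifted_change om i j)%:R))))).
  apply: eq_bigr => om _; rewrite switch_map_quad; congr (_ * (_ + _)).
  by apply: eq_bigr => i _; apply: eq_bigr => j _; rewrite mulNr mulNr.
rewrite /E noise_meanD (noise_mean_cst sys) -/E noise_mean_sum -addrA; congr (_ + _).
rewrite queue_totalE big_distrr -big_split; apply: eq_bigr => i _ /=.
rewrite noise_mean_sum big_distrr -big_split; apply: eq_bigr => j _ /=.
rewrite addrC /E.
rewrite (noise_meanD P a (fun om => (shifted_change om i j)%:R ^+ 2 - (shifted_change om i j)%:R)).
congr (_ + _); rewrite noise_meanZ.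
rewrite (noise_meanD P a (fun=> 1) (fun om => - (shifted_change om i j)%:R)).
rewrite (noise_mean_cst sys) (_ : (fun om => - _) = (fun om => -1 * (shifted_change om i j)%:R)).
  by rewrite noise_meanZ -/E shifted_change_mean; ring.
by apply/funext => om; rewrite mulN1r.
Qed.

Hypothesis slack_bounds : 0 < slack <= 1.

(** The contraction rate of an entry is the mean of z^(c-1) for c the shifted change;
    z^c <= 1 + (z - 1) c z^(amax+1) bounds the mean of z^c by
    1 + (z - 1) (1 - slack) z^(amax+1), which is below z once
    (1 - slack) z^(amax+1) < 1. *)
Lemma switch_contractive : exists z g C k : R, 1 < z /\
  contractive_iteration w switch_map (queue_dist z) 0 (@queue_total n) g C k.
Proof.
have [z z1 zA] := exists_exp_scale slack_bounds (ltn0Sn amax).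
have z0 : 0 < z by rewrite (lt_trans _ z1).
have slack1 : 0 <= 1 - slack by rewrite subr_ge0; case/andP: slack_bounds.
pose rho := 1 + (z - 1) * ((1 - slack) * z ^+ amax.+1).
have rho0 : 0 <= rho.
  by rewrite addr_ge0// mulr_ge0 ?subr_ge0 ?(ltW z1)// mulr_ge0// exprn_ge0// ltW.
have rhoz : rho < z.
  rewrite /rho -ltrBrDl -[ltRHS]mulr1 ltr_pM2l// subr_gt0//.
have mean_exp i j : E (fun om => z ^+ shifted_change om i j) <= rho.
  rewrite (_ : rho = E ((fun=> 1) \+
      (fun om => ((z - 1) * z ^+ amax.+1) * (shifted_change om i j)%:R))); last first.
    rewrite /E noise_meanD (noise_mean_cst sys) noise_meanZ -/E shifted_change_mean.
    by rewrite /rho; ring.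
  apply: ler_sum => om _; rewrite ler_wpM2l ?noise_weight_ge0//=.
  have cA : (shifted_change om i j <= amax.+1)%N.
    rewrite /shifted_change (leq_trans (leq_subr _ _))// addn1 ltnS.
    exact: noise_arrivals_le.
  rewrite (le_trans (exp_le_linear z1 cA))// lerD2l.
  by rewrite [_%:R * _]mulrC mulrA.
exists z, (rho / z), (n%:R ^+ 2 * (quad_const z * (z - 1))),
  (fine (P (a 0%N @^-1` [set 0])) / n`!%:R).
split=> //; split.
- exact: noise_weight_ge0.
- exact: (noise_weight_sum1 sys).
- exact: queue_dist_ge0.
- exact: queue_dist_ge1.
- exact: queue_dist_sym.
- exact: queue_dist_triangle.
- by rewrite divr_ge0// ltW.
- by rewrite ltr_pdivrMr// mul1r.
- move=> x y.
  apply: (@le_trans _ _ (\sum_i \sum_j E (fun om => z ^+ shifted_change om i j) / z *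
      ((z - 1)^-1 * `|z ^+ x i j - z ^+ y i j|))).
    apply: (@le_trans _ _ (E (fun om => \sum_i \sum_j z ^+ shifted_change om i j / z *
        ((z - 1)^-1 * `|z ^+ x i j - z ^+ y i j|)))).
      apply: ler_sum => om _; rewrite ler_wpM2l ?noise_weight_ge0//.
      exact: switch_map_contract.
    rewrite noise_mean_sum; apply: ler_sum => i _.
    rewrite noise_mean_sum; apply: ler_sum => j _.
    rewrite le_eqVlt; apply/orP; left; apply/eqP.
    rewrite -[RHS]mulrA [RHS]mulrC /E -noise_meanZ.
    by apply: eq_bigr => om _; congr (_ * _); rewrite -mulrA mulrC.
  rewrite /queue_dist big_distrr; apply: ler_sum => i _.
  rewrite big_distrr; apply: ler_sum => j _ /=.
  rewrite ler_wpM2r ?mulr_ge0 ?zV_ge0// ler_wpM2r// invr_ge0 ltW//.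
- exact: queue_total_sqr_le.
- exact: queue_total_finite.
- exact: queue_total_eq0.
- rewrite divr_gt0 ?ltr0n ?fact_gt0//.
  have a00 := arrival_zero (switch_arrivals sys) 0.
  rewrite fine_gt0// a00 /= ltey_eq fin_num_measure//.
  exact: (arrival_rv (switch_arrivals sys)).
- move=> x; have [p px] := switch_map_drain (amax := amax) x.
  exists (const_mx ord0, p) => //.
  rewrite /w /noise_weight (_ : noise_arrivals _ = 0)//.
  by apply/matrixP => i j; rewrite !mxE.
Qed.

(** Since the stationary means of the quadratic function and of its image by the
    transfer operator agree, the drift has stationary mean 0, which determines
    the mean of the total queue. *)
Lemma switch_mean_queue : exists mu : 'M[nat]_n -> \bar R,
  [/\ is_markov_chain (switch_kernel P a s) P (switch_states P a s) q,
      positive_recurrent (switch_kernel P a s) (switch_states P a s),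
      steady_state_law (switch_kernel P a s) P q mu &
      \esum_(x in [set: 'M[nat]_n]) (mu x * (queue_total x)%:R%:E)%E =
        (mean_excess / (2 * slack))%:E].
Proof.
have [z [g [C [k [z1 H]]]]] := switch_contractive.
have KE := switch_kernelE sys.
have HX := switch_driven_chain sys.
exists (limit_law w switch_map 0); split.
- exact: (driven_is_markov_chain KE H HX (switch_init sys)).
- exact: (positive_recurrent_reachable H KE).
- exact: (driven_steady_state KE H HX).
have Ltot := queue_total_lipschitz z1 (n := n).
rewrite (esum_limit_law H Ltot (c := 1)); last first.
  by move=> x; rewrite ler0n mul1r lerDr ler01.
have Lquad := queue_quad_lipschitz z1 (n := n).
have /eqP := limit_mean_transfer H Lquad.
rewrite (_ : transfer _ _ _ = (queue_quad \+
    (fun x => (-2 * slack) * (queue_total x)%:R)) \+ (fun=> mean_excess)); last first.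
  by apply/funext => x; rewrite queue_quad_transfer.
have Ls := dist_lipschitzZ (-2 * slack) Ltot.
have Lqs := dist_lipschitzD Lquad Ls.
rewrite (limit_meanD H Lqs (dist_lipschitz_cst _ mean_excess)).
rewrite (limit_meanD H Lquad Ls) (limit_meanZ H _ Ltot) (limit_mean_cst H).
rewrite -addrA -subr_eq0 addrAC subrr add0r => /eqP e.
have s0 : slack != 0 by case/andP: slack_bounds => /gt_eqF ->.
congr (_%:E); apply: (mulIf (_ : 2 * slack != 0)).
  by rewrite mulf_neq0// pnatr_eq0.
rewrite divfK ?mulf_neq0// ?pnatr_eq0//; lra.
Qed.

End random_scheduling_switch.

(** * The heavy-traffic limit *)

(** Noise values with some a_ij >= 2 have weight 0, so a_ij^2 and a_ij have the
    same mean. *)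
Lemma bernoulli_variance {R : realType} {n amax : nat}
    {disp : measure_display} {T : measurableType disp} (P : probability T R)
    (lam : R) (a s q : nat -> T -> 'M[nat]_n) (i j : 'I_n) :
  switch_system P amax (const_mx lam) a s q -> bernoulli_arrivals P lam a ->
  fine (variance P (arrival_real a i j 0)) = lam - lam ^+ 2.
Proof.
move=> sys bern; rewrite (noise_mean_var sys) /=.
pose b om : R := (noise_arrivals (n := n) (amax := amax) om i j)%:R.
rewrite (_ : (fun om => _) = ((fun om => b om ^+ 2 - b om) \+
    (fun om => (1 - 2 * lam) * b om)) \+ (fun=> lam ^+ 2)); last first.
  by apply/funext => om; rewrite /= -/(b om); ring.
rewrite 2!noise_meanD noise_meanZ (noise_mean_cst sys) (noise_mean_arrival sys).
suff -> : noise_mean P a (fun om => b om ^+ 2 - b om) = 0 by ring.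
apply: big1 => om _.
have [b1|b2] := leqP (noise_arrivals om i j) 1.
  by rewrite /b; case: (noise_arrivals om i j) b1 => [|[|//]] _;
    rewrite ?expr1n ?expr0n subrr mulr0.
suff -> : noise_weight P a om = 0 by rewrite mul0r.
apply/EFin_inj; rewrite -(driving_noise_law sys 0) /law.
have mA k : measurable (arrival_entry a i j 0 @^-1` [set k]).
  apply: (discrete_rv_comp (fun x : 'M[nat]_n => x i j)).
  exact: (arrival_rv (switch_arrivals sys)).
have [P1 P0] := bern 0%N i j.
apply: (@subset_measure0 _ _ _ P _ (~` (arrival_entry a i j 0 @^-1` [set 1%N] `|`
    arrival_entry a i j 0 @^-1` [set 0%N]))).
- exact: (driving_noise_rv sys).
- exact/measurableC/measurableU.
- move=> e /= eom; rewrite -eom (driving_arrivals sys) in b2.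
  by rewrite /arrival_entry => -[e1|e0]; rewrite ?e1 ?e0 in b2.
- rewrite [LHS](probability_setC P); last exact: measurableU.
  rewrite [X in (1 - X)%E](measureU P)//; last first.
    by apply/seteqP; split=> // e [/= ->].
  rewrite [X in (1 - (X + _))%E]P1 [X in (1 - (_ + X))%E]P0.
  by rewrite -[X in (1 - X)%E]EFinD (addrC lam) subrK subee.
Qed.

Lemma cvg_sum2 {R : realType} {n : nat} {T : Type} {F : set_system T}
    (f : 'I_n -> 'I_n -> T -> R) (l : 'I_n -> 'I_n -> R) : Filter F ->
  (forall i j, f i j x @[x --> F] --> l i j) ->
  \sum_i \sum_j f i j x @[x --> F] --> \sum_i \sum_j l i j.
Proof.
move=> FF fl; have ac : continuous (fun x : R * R => x.1 + x.2).
  exact: add_continuous.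
apply: (cvg_big (op := fun x y : R => x + y)) => // i _.
exact: (cvg_big (op := fun x y : R => x + y)).
Qed.

Section heavy_traffic.
Context {R : realType} (n amax : nat) (sigma : 'M[R]_n).
Context (d : R -> measure_display) (T : forall eps : R, measurableType (d eps)).
Context (P : forall eps : R, probability (T eps) R).
Context (a s q : forall eps : R, nat -> T eps -> 'M[nat]_n).
Arguments a : clear implicits.
Arguments s : clear implicits.
Arguments q : clear implicits.
Hypothesis n_gt0 : (0 < n)%N.
Hypothesis system : forall eps : R, 0 < eps < 1 ->
  switch_system (P eps) amax (const_mx ((1 - eps) / n%:R)) (a eps) (s eps) (q eps).
Hypothesis variances : forall i j : 'I_n,
  variance (P eps) (arrival_real (a eps) i j 0) @[eps --> 0^'+]
    --> (sigma i j ^+ 2)%:E.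

Let n_neq0 : n%:R != 0 :> R. Proof. by rewrite pnatr_eq0 -lt0n. Qed.

Let sum_cst (x : R) : \sum_(i < n) x = n%:R * x.
Proof. by rewrite sumr_const card_ord mulr_natl. Qed.

Lemma uniform_slack eps : slack (n := n) ((1 - eps) / n%:R : R) = eps / n%:R.
Proof. by rewrite /slack -{1}[n%:R^-1]mul1r -mulrBl; congr (_ / _); ring. Qed.

Lemma uniform_slack_bounds eps : 0 < eps < 1 ->
  0 < slack (n := n) ((1 - eps) / n%:R : R) <= 1.
Proof.
move=> /andP[e0 e1]; rewrite uniform_slack divr_gt0 ?ltr0n//=.
by rewrite ler_pdivrMr ?ltr0n// mul1r (le_trans (ltW e1))// ler1n.
Qed.

Lemma rate_cvg : (1 - eps) / n%:R @[eps --> 0^'+] --> (n%:R^-1 : R).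
Proof.
rewrite -[X in _ --> X]mul1r; apply: cvgM; last exact: cvg_cst.
rewrite -[X in _ --> X](subr0 1); apply: cvgB; first exact: cvg_cst.
exact: cvg_at_right_filter cvg_id.
Qed.

Lemma near0_unit : \forall eps \near (0 : R)^'+, 0 < eps < 1.
Proof.
near=> eps; apply/andP; split; near: eps; first exact: nbhs_right_gt.
exact: nbhs_right_lt.
Unshelve. all: by end_near. Qed.

Lemma mean_excess_cvg :
  n%:R / 2 * mean_excess (amax := amax) (P eps) (a eps) @[eps --> 0^'+]
    --> n%:R / 2 * frobenius_norm sigma ^+ 2 + n%:R * (n%:R - 1) / 2.
Proof.
have h : \sum_i \sum_j (fine (variance (P eps) (arrival_real (a eps) i j 0)) +
    ((1 - eps) / n%:R) ^+ 2 + (1 - eps) / n%:R - 2 * ((1 - eps) / n%:R / n%:R))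
    @[eps --> 0^'+] -->
    \sum_i \sum_j (sigma i j ^+ 2 + (n%:R^-1) ^+ 2 + n%:R^-1 - 2 * (n%:R^-1 / n%:R)).
  apply: cvg_sum2 => i j.
  apply: cvgB; last by apply: cvgM; [exact: cvg_cst|apply: cvgM; [exact: rate_cvg|exact: cvg_cst]].
  apply: cvgD; last exact: rate_cvg.
  apply: cvgD; first exact: fine_cvg (@variances i j).
  by rewrite !expr2; under eq_fun do rewrite expr2; apply: cvgM; exact: rate_cvg.
rewrite (_ : _ + _ = n%:R / 2 *
    \sum_i \sum_j (sigma i j ^+ 2 + (n%:R^-1) ^+ 2 + n%:R^-1 - 2 * (n%:R^-1 / n%:R))).
  apply: cvgM; first exact: cvg_cst.
  apply: cvg_trans h; apply: near_eq_cvg; near=> eps.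
  have e01 : 0 < eps < 1 by near: eps; exact: near0_unit.
  rewrite /mean_excess; apply: eq_bigr => i _; apply: eq_bigr => j _.
  by rewrite (shifted_change_excess (system e01)).
rewrite /frobenius_norm sqr_sqrtr; last first.
  by apply: sumr_ge0 => i _; apply: sumr_ge0 => j _; exact: sqr_ge0.
pose c : R := n%:R^-1 ^+ 2 + n%:R^-1 - 2 * (n%:R^-1 / n%:R).
have -> : \sum_i \sum_j (sigma i j ^+ 2 + n%:R^-1 ^+ 2 + n%:R^-1 - 2 * (n%:R^-1 / n%:R))
    = \sum_i \sum_j sigma i j ^+ 2 + n%:R * (n%:R * c).
  rewrite -!sum_cst -big_split; apply: eq_bigr => i _; rewrite -big_split.
  by apply: eq_bigr => j _; rewrite /c /= !addrA.
by rewrite /c; field.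
Unshelve. all: by end_near. Qed.

(** The steady-state law is the limit of the laws of q(t), hence equals the limit
    law, for which eps E[total] = (n / 2) M holds exactly. *)
Lemma mean_queue_limit (d' : R -> measure_display)
    (T' : forall eps : R, measurableType (d' eps))
    (P' : forall eps : R, probability (T' eps) R)
    (qbar : forall eps : R, T' eps -> 'M[nat]_n) :
  (forall eps : R, 0 < eps < 1 ->
     discrete_rv (qbar eps) /\
     steady_state_law (switch_kernel (P eps) (a eps) (s eps))
       (P eps) (q eps) (law (P' eps) (qbar eps))) ->
  (eps%:E * 'E_(P' eps)[fun w => ((queue_total (qbar eps w))%:R)%R])%E
    @[eps --> 0^'+]
    --> (n%:R / 2 * frobenius_norm sigma ^+ 2 + n%:R * (n%:R - 1) / 2)%:E.
Proof.
move=> steady.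
have h : (n%:R / 2 * mean_excess (amax := amax) (P eps) (a eps))%:E @[eps --> 0^'+]
    --> (n%:R / 2 * frobenius_norm sigma ^+ 2 + n%:R * (n%:R - 1) / 2)%:E.
  by apply: cvg_EFin; [exact: nearW|exact: mean_excess_cvg].
apply: cvg_trans h; apply: near_eq_cvg; near=> eps.
have e01 : 0 < eps < 1 by near: eps; exact: near0_unit.
have [mq steady_q] := steady _ e01.
have [mu [_ _ steady_mu mean_mu]] := switch_mean_queue (system e01)
  (uniform_slack_bounds e01).
have lawE x : law (P' eps) (qbar eps) x = mu x.
  have cvg_q : law (P eps) (q eps t) x @[t --> \oo] --> law (P' eps) (qbar eps) x.
    exact: (steady_limit steady_q).
  have cvg_mu : law (P eps) (q eps t) x @[t --> \oo] --> mu x.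
    exact: (steady_limit steady_mu).
  exact: (cvg_unique (@ereal_hausdorff R) cvg_q cvg_mu).
rewrite unlock (integral_discrete_rv (P' eps)
  (f := fun x : 'M[nat]_n => (queue_total x)%:R) mq)//.
under eq_esum do rewrite lawE.
rewrite mean_mu uniform_slack /= -EFinM; congr (_%:E).
have : eps != 0 by case/andP: e01 => /gt_eqF ->.
by move=> eps0; field; rewrite eps0 n_neq0.
Unshelve. all: by end_near. Qed.

(** The limit variances are not free for Bernoulli arrivals: they are the limits
    of lambda - lambda^2. *)
Lemma bernoulli_limit_variance :
  (forall eps : R, 0 < eps < 1 ->
     bernoulli_arrivals (P eps) ((1 - eps) / n%:R) (a eps)) ->
  forall i j, sigma i j ^+ 2 = n%:R^-1 - n%:R^-1 ^+ 2.
Proof.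
move=> bern i j.
apply: (cvg_unique (@Rhausdorff R) (fine_cvg (@variances i j))).
have h : (1 - eps) / n%:R - (1 - eps) / n%:R * ((1 - eps) / n%:R) @[eps --> 0^'+] -->
    (n%:R^-1 - n%:R^-1 * n%:R^-1 : R).
  by apply: cvgB; [exact: rate_cvg|apply: cvgM; exact: rate_cvg].
rewrite expr2; apply: cvg_trans h; apply: near_eq_cvg; near=> eps.
have e01 : 0 < eps < 1 by near: eps; exact: near0_unit.
by rewrite /= (bernoulli_variance i j (system e01) (bern _ e01)) expr2.
Unshelve. all: by end_near. Qed.

Lemma bernoulli_limitE : 
  (forall i j, sigma i j ^+ 2 = n%:R^-1 - n%:R^-1 ^+ 2) ->
  n%:R / 2 * frobenius_norm sigma ^+ 2 + n%:R * (n%:R - 1) / 2 = n%:R * (n%:R - 1).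
Proof.
move=> sE; rewrite /frobenius_norm sqr_sqrtr; last first.
  by apply: sumr_ge0 => i _; apply: sumr_ge0 => j _; exact: sqr_ge0.
under eq_bigr do under eq_bigr do rewrite sE.
rewrite !sum_cst.
by field.
Qed.

End heavy_traffic.

Local Open Scope ereal_scope.

Theorem proposition4 (R : realType) (n amax : nat) (sigma : 'M[R]_n)
    (d : R -> measure_display) (T : forall eps : R, measurableType (d eps))
    (P : forall eps : R, probability (T eps) R)
    (a s q : forall eps : R, nat -> T eps -> 'M[nat]_n)
    (n_gt0 : (0 < n)%N)
    (system : forall eps : R, (0 < eps < 1)%R ->
       switch_system (P eps) amax (const_mx ((1 - eps) / n%:R)%R)
         (a eps) (s eps) (q eps))
    (variances : forall i j : 'I_n,
       variance (P eps) (arrival_real (a eps) i j 0) @[eps --> 0^'+]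
         --> (sigma i j ^+ 2)%R%:E) :
  [/\ forall eps : R, (0 < eps < 1)%R ->
        let K := switch_kernel (P eps) (a eps) (s eps) in
        let D := switch_states (P eps) (a eps) (s eps) in
        is_markov_chain K (P eps) D (q eps) /\ positive_recurrent K D,
      forall eps : R, (0 < eps < 1)%R ->
        exists mu : 'M[nat]_n -> \bar R,
          steady_state_law (switch_kernel (P eps) (a eps) (s eps))
            (P eps) (q eps) mu
    & forall (d' : R -> measure_display)
        (T' : forall eps : R, measurableType (d' eps))
        (P' : forall eps : R, probability (T' eps) R)
        (qbar : forall eps : R, T' eps -> 'M[nat]_n),
        (forall eps : R, (0 < eps < 1)%R ->
           discrete_rv (qbar eps) /\
           steady_state_law (switch_kernel (P eps) (a eps) (s eps))
             (P eps) (q eps) (law (P' eps) (qbar eps))) ->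
        (eps%:E * 'E_(P' eps)[fun w => ((queue_total (qbar eps w))%:R)%R]
           @[eps --> 0^'+]
           --> (n%:R / 2 * frobenius_norm sigma ^+ 2
                + n%:R * (n%:R - 1) / 2)%R%:E) /\
        ((forall eps : R, (0 < eps < 1)%R ->
            bernoulli_arrivals (P eps) ((1 - eps) / n%:R)%R (a eps)) ->
         eps%:E * 'E_(P' eps)[fun w => ((queue_total (qbar eps w))%:R)%R]
           @[eps --> 0^'+]
           --> (n%:R * (n%:R - 1))%R%:E)].
Proof.
split=> [eps e01|eps e01|d' T' P' qbar steady].
- have [mu [? ? _ _]] := switch_mean_queue (system _ e01) (uniform_slack_bounds n_gt0 e01).
  by split.
- have [mu [_ _ ? _]] := switch_mean_queue (system _ e01) (uniform_slack_bounds n_gt0 e01).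
  by exists mu.
have lim := mean_queue_limit n_gt0 system variances steady.
split=> // bern.
by rewrite -(bernoulli_limitE n_gt0 (bernoulli_limit_variance system variances bern)).
Qed.
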